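(* Assume (A1)–(A5) as in the context. If $M_{\rm max}(L)$ diverges to infinity not too rapidly as $L\uparrow\infty$, one has $$\lim_{L\uparrow\infty}\langle\Xi_L^{(1,0)}|\Bigl(\frac{\hat{\mathcal O}_L^{(1)}}{V}\Bigr)|\Xi_L^{(1,0)}\rangle=m^*,\qquad \lim_{L\uparrow\infty}\langle\Xi_L^{(1,0)}|\Bigl(\frac{\hat{\mathcal O}_L^{(1)}}{V}\Bigr)^2|\Xi_L^{(1,0)}\rangle=(m^* )^2,$$ $$\langle\Xi_L^{(1,0)}|\Bigl(\frac{\hat{\mathcal O}_L^{(2)}}{V}\Bigr)|\Xi_L^{(1,0)}\rangle=0,\qquad \lim_{L\uparrow\infty}\langle\Xi_L^{(1,0)}|\Bigl(\frac{\hat{\mathcal O}_L^{(2)}}{V}\Bigr)^2|\Xi_L^{(1,0)}\rangle=0.$$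
   Context: Setting. Fix $d\ge1$. For even $L$ let $\Lambda_L=\{x\in\mathbb Z^d: -L/2<x_i\le L/2\}$ be the hypercubic lattice with periodic boundary conditions and $V=L^d$ sites. We consider a quantum many-body system on $\Lambda_L$ (the Hilbert space is the tensor product over $x\in\Lambda_L$ of copies of a fixed finite-dimensional space; an operator ''acts on'' a set of sites if it is the tensor product of an operator on those sites with the identity elsewhere). $\|\cdot\|$ is the operator norm for operators and the Hilbert space norm for vectors. The Hamiltonian is $\hat H_L=\sum_{x\in\Lambda_L}\hat h_x$, with all $\hat h_x$ translational copies of each other. $|\Phi_L^{\rm gs}\rangle$ is the normalized ground state of $\hat H_L$. The constants $a,\zeta,h_0,o_0,q_0$ below do not depend on $L$. (A1) There is a self-adjoint $\hat C_L$ with $[\hat C_L,\hat h_x]=0$ for any $x$ (hence $[\hat C_L,\hat H_L]=0$), and $-aV\le\hat C_L\le aV$ with a constant $a>0$. (A2) There are order operators $\hat{\mathcal O}_L^{(\alpha)}=\sum_{x\in\Lambda_L}\hat o_x^{(\alpha)}$, $\alpha=1,2$, with $\hat o_x^{(\alpha)}$ self-adjoint and translationally invariant, satisfying $[\hat{\mathcal O}_L^{(1)},\hat C_L]=-i\hat{\mathcal O}_L^{(2)}$, $[\hat{\mathcal O}_L^{(2)},\hat C_L]=i\hat{\mathcal O}_L^{(1)}$, $[\hat{\mathcal O}_L^{(1)},\hat{\mathcal O}_L^{(2)}]=i\hat C_L$. (A3) $\hat h_x$ acts on at most $\zeta$ sites including $x$; $\hat o_x^{(1)},\hat o_x^{(2)}$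 act only on site $x$. Write $h_0=\|\hat h_x\|$ and $o_0=\|\hat o_x^{(1)}\pm i\hat o_x^{(2)}\|$, independent of $x$. (A4) The ground state $|\Phi_L^{\rm gs}\rangle$ of $\hat H_L$ for finite $L$ is unique and satisfies $\hat C_L|\Phi_L^{\rm gs}\rangle=M_L|\Phi_L^{\rm gs}\rangle$. (A5) There is a constant $q_0$ independent of $L$ with $\langle\Phi_L^{\rm gs}|(\hat{\mathcal O}_L^{(1)}/V)^2|\Phi_L^{\rm gs}\rangle=\langle\Phi_L^{\rm gs}|(\hat{\mathcal O}_L^{(2)}/V)^2|\Phi_L^{\rm gs}\rangle\ge q_0>0$. Let $\hat{\mathcal O}_L^\pm=\hat{\mathcal O}_L^{(1)}\pm i\hat{\mathcal O}_L^{(2)}$. For $M=1,2,\dots$ define $$|\Gamma_L^{\pm M}\rangle=\frac{(\hat{\mathcal O}_L^\pm)^M|\Phi_L^{\rm gs}\rangle}{\|(\hat{\mathcal O}_L^\pm)^M|\Phi_L^{\rm gs}\rangle\|},\qquad |\Gamma_L^0\rangle=|\Phi_L^{\rm gs}\rangle.$$ $C_1>0$ is an $L$-independent constant such that $|\Gamma_L^M\rangle$ is well-defined for all integers $M$ with $|M|\le C_1\sqrt V$. For an integer-valued function $M_{\rm max}(L)>0$ with $M_{\rm max}(L)\le C_1\sqrt V$ define $$|\Xi_L^{(1,0)}\rangle=\frac{1}{\sqrt{2M_{\rm max}(L)+1}}\sum_{M=-M_{\rm max}(L)}^{M_{\rm max}(L)}|\Gamma_L^M\rangle .$$ The phrase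 ''not too rapidly'' is not quantified in the source: what its proof provides is the existence of a function $M_{\rm max}(L)$ with $M_{\rm max}(L)\uparrow\infty$ for which the relations hold; it does not tell whether a concrete choice of $M_{\rm max}(L)$ is suitable. Symmetry breaking order parameter: $$m^*:=\lim_{k\uparrow\infty}\lim_{L\uparrow\infty}\Bigl\{\langle\Phi_L^{\rm gs}|\Bigl(\frac{\hat{\mathcal O}_L^{(\alpha)}}{V}\Bigr)^{2k}|\Phi_L^{\rm gs}\rangle\Bigr\}^{1/(2k)},$$ where $k$ takes integer values and $\alpha=1$ or $2$. The limit $k\uparrow\infty$ exists; the existence of the limit $L\uparrow\infty$ is not guaranteed in general, and one may take a subsequence (or replace $\lim$ with $\limsup$ or $\liminf$) if necessary. *)

(* Defs.v *)
From HB Require Import structures.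
From mathcomp Require Import all_boot all_order all_algebra.
From mathcomp Require Import spectral sesquilinear complex.
From mathcomp Require Import all_classical all_reals all_analysis.
Import Order.TTheory GRing.Theory Num.Theory.
Import numFieldNormedType.Exports.

Set Implicit Arguments.
Unset Strict Implicit.
Unset Printing Implicit Defensive.

Local Open Scope ring_scope.
Local Open Scope complex_scope.
Local Open Scope sesquilinear_scope.

(* Side lengths are even and positive, hence at least 2. *)
Definition lattice_size (L : nat) : bool := (0 < L)%N && ~~ odd L.

(* Lambda_L with periodic boundary conditions is (Z/LZ)^d: a site is given by
   the residues mod L of its coordinates, and translations are the additions
   of the group 'rV['Z_L]_d.  Since 'Z_L is Z/LZ only for L > 1, sites are only
   used for L such that lattice_size L. *)
Definition site (d L : nat) := 'rV['Z_L]_d.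

Definition volume (d L : nat) : nat := (L ^ d)%N.

(* The tensor product over the sites of copies of C^D is realized through its
   product basis, which is indexed by the configurations. *)
Definition config (d D L : nat) := {ffun site d L -> 'I_D}.

Definition state (R : realType) (d D L : nat) := 'cV[R[i]]_#|config d D L|.

Definition oper (R : realType) (d D L : nat) := 'M[R[i]]_#|config d D L|.

Section HilbertSpace.
Variables (R : realType) (n : nat).
Implicit Types (A B : 'M[R[i]]_n) (u v : 'cV[R[i]]_n).

Definition inner u v : R[i] := (u ^t* *m v) 0 0.

(* The norm that mathcomp-analysis puts on matrices is the sup norm of the
   entries, hence the explicit definitions of the Hilbert space norm and of the
   operator norm. *)
Definition vnorm v : R := Num.sqrt (complex.Re (inner v v)).

Definition opnorm A : R := sup [set vnorm (A *m v) | v in [set v | vnorm v <= 1]].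

Definition selfadjoint A : Prop := A \is hermsymmx.

Definition commutator A B : 'M[R[i]]_n := A *m B - B *m A.

Definition oper_le A B : Prop := forall v, 0 <= inner v ((B - A) *m v).

(* <v|A|v>; the real part loses nothing when A is self-adjoint, see
   expval_selfadjoint below. *)
Definition expval A v : R := complex.Re (inner v (A *m v)).

Definition normalize v : 'cV[R[i]]_n := ((vnorm v)^-1)%:C *: v.

Definition eigenpair A (E : R[i]) v : Prop := v != 0 /\ A *m v = E *: v.

Definition ground_state A v : Prop :=
  vnorm v = 1 /\
  exists E, eigenpair A E v /\ forall E' u, eigenpair A E' u -> E <= E'.

Definition unique_ground_state A v : Prop :=
  ground_state A v /\ forall u, ground_state A u -> exists c, u = c *: v.

Lemma expval_selfadjoint A v :
  selfadjoint A -> inner v (A *m v) = (expval A v)%:C.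
Proof.
move=> /is_hermitianmxP; rewrite expr0 scale1r => hA.
have key : (inner v (A *m v))^* = inner v (A *m v).
  rewrite /inner.
  have -> : ((v ^t* *m (A *m v)) 0 0)^* = ((v ^t* *m (A *m v)) ^t*) 0 0.
    by rewrite !mxE.
  by rewrite !trmx_mul !map_mxM trmxCK -hA mulmxA.
rewrite /expval; apply/eqP; rewrite eq_complex /= eqxx /=.
case: (inner _ _) key => x y /= [/eqP].
by rewrite eq_sym -subr_eq0 opprK -mulr2n mulrn_eq0.
Qed.

End HilbertSpace.

Section Lattice.
Variables (R : realType) (d D L : nat).
Implicit Types (A : oper R d D L) (s t : config d D L) (x y : site d L).

Definition entry A s t : R[i] := A (enum_rank s) (enum_rank t).

Definition restrict (X : {set site d L}) s : {ffun {x | x \in X} -> 'I_D} :=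
  [ffun x => s (val x)].

(* A = B (x) 1, with B an operator on the sites of X. *)
Definition acts_on (X : {set site d L}) A : Prop :=
  exists B : {ffun {x | x \in X} -> 'I_D} -> {ffun {x | x \in X} -> 'I_D} -> R[i],
  forall s t, entry A s t =
    B (restrict X s) (restrict X t) * [forall x in ~: X, s x == t x]%:R.

Definition shift y s : config d D L := [ffun x => s (x + y)].

(* The copy of A translated by y, U_y A U_y^* with U_y |s> = |s(. - y)>. *)
Definition translate y A : oper R d D L :=
  \matrix_(i, j) entry A (shift y (enum_val i)) (shift y (enum_val j)).

Definition translation_covariant (A : site d L -> oper R d D L) : Prop :=
  forall x y, A (x + y) = translate y (A x).

(* A / V *)
Definition density A : oper R d D L := (volume d L)%:R^-1 *: A.

End Lattice.

Inductive component := comp1 | comp2.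

Record lattice_system (R : realType) (d D : nat) := LatticeSystem {
  hloc : forall L, site d L -> oper R d D L;
  cop : forall L, oper R d D L;
  oloc : component -> forall L, site d L -> oper R d D L;
  gs : forall L, state R d D L
}.

Section System.
Variables (R : realType) (d D : nat) (S : lattice_system R d D).

Definition ham L : oper R d D L := \sum_x hloc S x.

Definition order_op (al : component) L : oper R d D L := \sum_x oloc S al x.

Definition hamiltonian L : Prop :=
  translation_covariant (@hloc _ _ _ S L) /\ selfadjoint (ham L).

Definition conserved_operator (a : R) L : Prop :=
  [/\ selfadjoint (cop S L),
      forall x, commutator (cop S L) (hloc S x) = 0,
      oper_le (- (a * (volume d L)%:R)%:C)%:M (cop S L) &
      oper_le (cop S L) ((a * (volume d L)%:R)%:C)%:M].

Definition order_operators L : Prop :=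
  [/\ forall al x, selfadjoint (oloc S al x : oper R d D L),
      forall al, translation_covariant (@oloc _ _ _ S al L),
      commutator (order_op comp1 L) (cop S L) = - 'i *: order_op comp2 L,
      commutator (order_op comp2 L) (cop S L) = 'i *: order_op comp1 L &
      commutator (order_op comp1 L) (order_op comp2 L) = 'i *: cop S L].

Definition local_operators (zeta : nat) (h0 o0 : R) L : Prop :=
  [/\ forall x : site d L, exists X : {set site d L},
        [/\ x \in X, (#|X| <= zeta)%N & acts_on X (hloc S x)],
      forall al (x : site d L), acts_on [set x] (oloc S al x),
      forall x : site d L, opnorm (hloc S x) = h0,
      forall x : site d L, opnorm (oloc S comp1 x + 'i *: oloc S comp2 x) = o0 &
      forall x : site d L, opnorm (oloc S comp1 x - 'i *: oloc S comp2 x) = o0].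

Definition symmetric_ground_state L : Prop :=
  unique_ground_state (ham L) (gs S L) /\
  exists m : R[i], cop S L *m gs S L = m *: gs S L.

Definition long_range_order (q0 : R) L : Prop :=
  expval (density (order_op comp1 L) ^+ 2) (gs S L) =
    expval (density (order_op comp2 L) ^+ 2) (gs S L) /\
  q0 <= expval (density (order_op comp1 L) ^+ 2) (gs S L).

Definition raising L : oper R d D L := order_op comp1 L + 'i *: order_op comp2 L.

Definition lowering L : oper R d D L := order_op comp1 L - 'i *: order_op comp2 L.

Definition tower_vector L (M : int) : state R d D L :=
  match M with
  | Posz n => raising L ^+ n *m gs S L
  | Negz n => lowering L ^+ n.+1 *m gs S L
  end.

Definition Gamma L (M : int) : state R d D L :=
  if M == 0 then gs S L else normalize (tower_vector L M).

(* The index i : 'I_(2 Mmax + 1) stands for M = i - Mmax. *)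
Definition Xi L (Mmax : nat) : state R d D L :=
  ((Num.sqrt (Mmax.*2.+1)%:R)^-1)%:C *:
    \sum_(i < Mmax.*2.+1) Gamma L (i%:Z - Mmax%:Z).

Definition tower_bound (C1 : R) L : R := C1 * Num.sqrt (volume d L)%:R.

Definition tower_well_defined (C1 : R) L : Prop :=
  forall M : int, `|M|%:~R <= tower_bound C1 L -> tower_vector L M != 0.

(* The constraint 0 < Mmax(L) <= C1 sqrt V can only be met when
   1 <= C1 sqrt V, that is, for all but finitely many L. *)
Definition admissible (C1 : R) (Mmax : nat -> nat) : Prop :=
  forall L, lattice_size L -> 1 <= tower_bound C1 L ->
  (0 < Mmax L)%N /\ (Mmax L)%:R <= tower_bound C1 L.

Definition order_moment (al : component) (k L : nat) : R :=
  expval (density (order_op al L) ^+ (k.*2)) (gs S L) `^ (k.*2%:R)^-1.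

(* m^*, the limit L -> oo being taken along the sizes sz 0 < sz 1 < ... *)
Definition order_parameter (al : component) (sz : nat -> nat) : R :=
  limn (fun k : nat => limn (fun j : nat => order_moment al k (sz j))).

End System.

(* Main.v *)
(* Let p = O^+/V and q = O^-/V.  Since [p, q] = 2C/V^2 and C has size O(V) on the
   vectors involved, p and q commute up to O(1/V) there.  With s_k the limit of
   ||p^k Phi||^2, normal ordering and charge conservation give
   <(O^(alpha)/V)^(2k)> -> 4^-k 'C(2k, k) s_k.  By Cauchy-Schwarz s is
   log-convex, so s_(k+1)/s_k increases to a limit l > 0, and the 2k-th roots of the
   moments tend to sqrt l: thus m^* = sqrt l.

   For fixed M, the vectors p Gamma^M - m^* Gamma^(M+1) and
   q Gamma^M - m^* Gamma^(M-1) have norms which, as L -> oo, tend to limits that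
   vanish as |M| -> oo.  They are mutually orthogonal for distinct M, so if
   Mmax(L) grows slowly enough, ||p Xi - m^* Xi|| and ||q Xi - m^* Xi|| are
   square roots of Cesaro means that tend to 0.  Hence (O^(1)/V) Xi is close to
   m^* Xi and (O^(2)/V) Xi is close to 0.  The expectation of O^(2) in Xi vanishes
   exactly because the matrix elements of p between the Gamma^M are real. *)
Require Import Defs.
From mathcomp Require Import all_boot all_order all_algebra.
From mathcomp Require Import complex spectral sesquilinear.
From mathcomp Require Import all_classical all_reals all_analysis.
From mathcomp Require Import ring lra zify.
Import Order.TTheory GRing.Theory Num.Theory.
Import numFieldNormedType.Exports.
Local Open Scope classical_set_scope.
Local Open Scope ring_scope.

Set Implicit Arguments.
Unset Strict Implicit.
Unset Printing Implicit Defensive.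

(** * The real inner product *)

(** The limits s_k come with no rate in the size and nothing is uniform in k, so the argument yields
    no explicit cutoff. Instead a null sequence [e] is fixed such that [e k] strictly exceeds the
    limits of the four squared errors at height k (p and q, each on both sides of the tower). The
    errors themselves are then below [e k] from some size on, which depends on k, and [g] is a
    diagonal choice of the height up to which these bounds hold. They are required at every k below
    the height, so a smaller diverging [Mmax] inherits them.

    Raising on the negative half of the tower undoes a lowering. Both halves are therefore covered
    by one analysis, applied to a ladder and to the same ladder with p and q exchanged.

    Convergence is assumed for the moments of a single component [alpha]. It yields the s_k because
    the factor 4^-k 'C(2k, k) is nonzero, and from then on both components are governed by the same
    s_k. The bound [q0] enters as s_1 > 0: with s_0 = 1 and log-convexity it makes all s_k positive,
    so that the ratios and the normalizations pass to the limit. *)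

Section RealInner.
Variables (R : realType) (n : nat).
Implicit Types (u v w : 'cV[R[i]]_n) (A : 'M[R[i]]_n) (a b : R).

(* The eigenvalues of the conserved charge are real, so the real part of the
   inner product already makes its eigenvectors orthogonal. *)
Definition rinner u v : R := complex.Re (inner u v).

Definition cmul (a : R) v : 'cV[R[i]]_n := (a%:C)%C *: v.

Lemma innerC u v : inner u v = (inner v u)^*.
Proof.
rewrite /inner !mxE rmorph_sum; apply: eq_bigr => i _.
by rewrite !mxE rmorphM /= conjCK mulrC.
Qed.

Lemma rinnerC u v : rinner u v = rinner v u.
Proof. by rewrite /rinner innerC; case: (inner v u). Qed.

Lemma rinnerDr u v w : rinner u (v + w) = rinner u v + rinner u w.
Proof. by rewrite /rinner /inner mulmxDr mxE raddfD. Qed.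

Lemma rinnerDl u v w : rinner (v + w) u = rinner v u + rinner w u.
Proof. by rewrite rinnerC rinnerDr !(rinnerC u). Qed.

Lemma rinnerZr a u v : rinner u (cmul a v) = a * rinner u v.
Proof.
rewrite /rinner /inner /cmul -scalemxAr mxE.
by case: ((_ *m _) 0 0) => x y /=; rewrite mul0r subr0.
Qed.

Lemma rinnerZl a u v : rinner (cmul a u) v = a * rinner u v.
Proof. by rewrite rinnerC rinnerZr rinnerC. Qed.

Lemma cmulN1 v : cmul (- 1) v = - v.
Proof. by rewrite /cmul rmorphN1 scaleN1r. Qed.

Lemma rinnerNr u v : rinner u (- v) = - rinner u v.
Proof. by rewrite -cmulN1 rinnerZr mulN1r. Qed.

Lemma rinnerNl u v : rinner (- u) v = - rinner u v.
Proof. by rewrite -cmulN1 rinnerZl mulN1r. Qed.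

Lemma rinner0r u : rinner u 0 = 0.
Proof. by rewrite -(subrr u) rinnerDr rinnerNr subrr. Qed.

Lemma rinner_sumr (I : Type) (r : seq I) (P : pred I) u (F : I -> 'cV[R[i]]_n) :
  rinner u (\sum_(i <- r | P i) F i) = \sum_(i <- r | P i) rinner u (F i).
Proof. exact: (big_morph (rinner u) (rinnerDr u) (rinner0r u)). Qed.

Lemma rinner_suml (I : Type) (r : seq I) (P : pred I) u (F : I -> 'cV[R[i]]_n) :
  rinner (\sum_(i <- r | P i) F i) u = \sum_(i <- r | P i) rinner (F i) u.
Proof. by rewrite rinnerC rinner_sumr; apply: eq_bigr => i _; rewrite rinnerC. Qed.

Lemma rinnerE u : rinner u u = \sum_i ((complex.Re (u i 0)) ^+ 2 + (complex.Im (u i 0)) ^+ 2).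
Proof.
rewrite /rinner /inner mxE raddf_sum; apply: eq_bigr => i _.
rewrite !mxE; case: (u i 0) => x y /=; ring.
Qed.

Lemma rinner_ge0 u : 0 <= rinner u u.
Proof. by rewrite rinnerE sumr_ge0// => i _; rewrite addr_ge0 ?sqr_ge0. Qed.

Lemma rinner_eq0 u : rinner u u = 0 -> u = 0.
Proof.
rewrite rinnerE => /eqP; rewrite psumr_eq0 => [|i _]; last by rewrite addr_ge0 ?sqr_ge0.
move=> /allP h; apply/matrixP => i j; rewrite (ord1 j) mxE.
have := h i; rewrite mem_index_enum => /(_ isT) /=.
rewrite paddr_eq0 ?sqr_ge0// !sqrf_eq0 => /andP[/eqP h1 /eqP h2].
by apply/eqP; rewrite eq_complex h1 h2 !eqxx.
Qed.

(** Multiplication by 'i is an isometry of square -1, hence skew for the real inner product; in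
    particular the product of v and 'i v vanishes. *)
Lemma rinner_i u v : rinner u ('i *: v) = - rinner ('i *: u) v.
Proof.
rewrite /rinner /inner -scalemxAr linearZ map_mxZ /= -scalemxAl !mxE.
by rewrite conjCi mulNr raddfN opprK.
Qed.

Lemma rinner_ii u v : rinner ('i *: u) ('i *: v) = rinner u v.
Proof. by rewrite rinner_i scalerA -expr2 sqrCi scaleN1r rinnerNl opprK. Qed.

Lemma vnorm_ge0 v : 0 <= vnorm v. Proof. exact: sqrtr_ge0. Qed.

Lemma vnorm_sqr v : vnorm v ^+ 2 = rinner v v.
Proof. by rewrite sqr_sqrtr// rinner_ge0. Qed.

Lemma vnorm_eq0 v : vnorm v = 0 -> v = 0.
Proof. by move=> h; apply: rinner_eq0; rewrite -vnorm_sqr h expr0n. Qed.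

Lemma vnorm0 : vnorm (0 : 'cV[R[i]]_n) = 0.
Proof. by apply/eqP; rewrite -sqrf_eq0 vnorm_sqr rinner0r. Qed.

Lemma vnormZ a v : vnorm (cmul a v) = `|a| * vnorm v.
Proof.
apply/eqP; rewrite -(@eqrXn2 _ 2)// ?vnorm_ge0 ?mulr_ge0 ?vnorm_ge0//.
by rewrite exprMn !vnorm_sqr real_normK ?num_real// rinnerZl rinnerZr mulrA expr2.
Qed.

Lemma vnormN v : vnorm (- v) = vnorm v.
Proof. by rewrite -cmulN1 vnormZ normrN1 mul1r. Qed.

Lemma vnormi v : vnorm ('i *: v) = vnorm v.
Proof.
by apply/eqP; rewrite -(@eqrXn2 _ 2)// ?vnorm_ge0// !vnorm_sqr rinner_ii.
Qed.

Lemma cauchy_schwarz u v : `|rinner u v| <= vnorm u * vnorm v.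
Proof.
rewrite -(@ler_pXn2r _ 2) ?nnegrE ?mulr_ge0 ?vnorm_ge0//.
rewrite exprMn !vnorm_sqr real_normK ?num_real//.
have [v0|vn0] := eqVneq (rinner v v) 0.
  by rewrite (rinner_eq0 v0) !rinner0r expr0n mulr0.
have v_gt0 : 0 < rinner v v by rewrite lt_def vn0 rinner_ge0.
(* The residue of the projection of u on v, multiplied by the squared norm of v to avoid a
   division. *)
have := rinner_ge0 (cmul (rinner v v) u - cmul (rinner u v) v).
rewrite !(rinnerDr, rinnerDl, rinnerNr, rinnerNl, rinnerZr, rinnerZl) (rinnerC v u).
move: v_gt0; move: (rinner u u) (rinner v v) (rinner u v) => x y z y_gt0.
have -> : y * (y * x) - y * (z * z) + (- (z * (y * z)) - - (z * (z * y))) = y * (x * y - z ^+ 2).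
  by ring.
by rewrite pmulr_rge0// subr_ge0.
Qed.

Lemma vnormD u v : vnorm (u + v) <= vnorm u + vnorm v.
Proof.
rewrite -(@ler_pXn2r _ 2) ?nnegrE ?addr_ge0 ?vnorm_ge0//.
have := le_trans (ler_norm _) (cauchy_schwarz u v).
rewrite sqrrD !vnorm_sqr !(rinnerDr, rinnerDl) (rinnerC v u).
move: (rinner u u) (rinner v v) (rinner u v) (vnorm u * vnorm v) => x y z t; lra.
Qed.

Lemma vnormB u v : vnorm (u - v) <= vnorm u + vnorm v.
Proof. by rewrite -(vnormN v) vnormD. Qed.

Lemma vnorm_sum (I : Type) (r : seq I) (P : pred I) (F : I -> 'cV[R[i]]_n) :
  vnorm (\sum_(i <- r | P i) F i) <= \sum_(i <- r | P i) vnorm (F i).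
Proof.
elim/big_ind2 : _ => [|x a y b xa yb|//]; first by rewrite vnorm0.
by rewrite (le_trans (vnormD _ _))// lerD.
Qed.

Lemma vnormBC u v : vnorm (u - v) = vnorm (v - u).
Proof. by rewrite -vnormN opprB. Qed.

Lemma ler_vnorm_dist u v : `|vnorm u - vnorm v| <= vnorm (u - v).
Proof.
have := vnormD (v - u) u; have := vnormD (u - v) v; rewrite !subrK (vnormBC v u).
move: (vnorm u) (vnorm v) (vnorm (u - v)) => x y z.
by rewrite ler_norml => ? ?; apply/andP; split; lra.
Qed.

Lemma vnormD_sqr u v : vnorm (u + v) ^+ 2 <= 2 * vnorm u ^+ 2 + 2 * vnorm v ^+ 2.
Proof.
have := rinner_ge0 (u - v).
rewrite !vnorm_sqr !(rinnerDr, rinnerDl, rinnerNr, rinnerNl) (rinnerC v u).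
move: (rinner u u) (rinner v v) (rinner u v) => x y z; lra.
Qed.

Lemma pythagoras (r : seq nat) (F : nat -> 'cV[R[i]]_n) : uniq r ->
  (forall i j, i != j -> rinner (F i) (F j) = 0) ->
  vnorm (\sum_(i <- r) F i) ^+ 2 = \sum_(i <- r) vnorm (F i) ^+ 2.
Proof.
move=> + F0; elim: r => [|i r IH] /=; first by rewrite !big_nil vnorm0 expr0n.
move=> /andP[ir ur]; rewrite !big_cons -IH// !vnorm_sqr !(rinnerDr, rinnerDl).
rewrite [rinner (\sum_(_ <- _) _) (F i)]rinnerC.
have -> : rinner (F i) (\sum_(j <- r) F j) = 0.
  rewrite rinner_sumr big1_seq// => j /andP[_ jr]; apply: F0.
  by apply: contraNneq ir => ->.
by rewrite addr0 add0r.
Qed.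

Lemma vnorm_coord v (i : 'I_n) :
  `|complex.Re (v i 0)| <= vnorm v /\ `|complex.Im (v i 0)| <= vnorm v.
Proof.
have h : (complex.Re (v i 0)) ^+ 2 + (complex.Im (v i 0)) ^+ 2 <= vnorm v ^+ 2.
  rewrite vnorm_sqr rinnerE (bigD1 i)//= lerDl.
  by rewrite sumr_ge0// => j _; rewrite addr_ge0 ?sqr_ge0.
have sqr_le (x : R) : x ^+ 2 <= vnorm v ^+ 2 -> `|x| <= vnorm v.
  by move=> xv; rewrite -(@ler_pXn2r _ 2) ?nnegrE ?vnorm_ge0// real_normK ?num_real.
by split; apply: sqr_le; apply: le_trans h; rewrite ?lerDl ?lerDr sqr_ge0.
Qed.

(** [opnorm] is a [sup], which bounds its set only if the set has some upper bound. A crude one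
    through the columns of [A] is enough; the factor 2 accounts for the real and imaginary parts of
    a coordinate. *)
Lemma vnorm_mul_bounded A : exists2 K : R, 0 <= K & forall v, vnorm (A *m v) <= K * vnorm v.
Proof.
exists (\sum_j 2 * vnorm (col j A)).
  by rewrite sumr_ge0// => j _; rewrite mulr_ge0 ?vnorm_ge0.
move=> v.
have -> : A *m v = \sum_j (cmul (complex.Re (v j 0)) (col j A) +
                            cmul (complex.Im (v j 0)) ('i *: col j A)).
  apply/matrixP => i k; rewrite (ord1 k) mxE summxE; apply: eq_bigr => j _.
  rewrite !mxE {1}[v j 0]complexE; set x := _%:C%C; set y := _%:C%C.
  rewrite -[('i)%C]/('i : R[i]); ring.
rewrite (le_trans (vnorm_sum _ _ _))// mulr_suml ler_sum// => j _.
have [re im] := vnorm_coord v j.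
rewrite (le_trans (vnormD _ _))// !vnormZ vnormi -mulrDl mulrAC ler_wpM2r ?vnorm_ge0//.
lra.
Qed.

Lemma vnorm_opnorm A v : vnorm (A *m v) <= opnorm A * vnorm v.
Proof.
have [K K0 AK] := vnorm_mul_bounded A.
have [v0|vn0] := eqVneq (vnorm v) 0.
  by rewrite (vnorm_eq0 v0) mulmx0 vnorm0 mulr0.
have v_gt0 : 0 < vnorm v by rewrite lt_def vn0 vnorm_ge0.
rewrite -ler_pdivrMr// mulrC.
rewrite -[X in X * _]ger0_norm ?invr_ge0 ?vnorm_ge0// -vnormZ /cmul scalemxAr.
apply: sup_upper_bound; last first.
  by exists (cmul (vnorm v)^-1 v) => //=; rewrite vnormZ ger0_norm ?invr_ge0 ?vnorm_ge0// mulVf.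
split; first by exists (vnorm (A *m 0)), 0 => //=; rewrite vnorm0.
exists K => _ [w /= w1 <-]; rewrite (le_trans (AK w))//.
by rewrite -[leRHS]mulr1 ler_wpM2l.
Qed.

Lemma selfadjointP A : selfadjoint A -> forall u v, inner u (A *m v) = inner (A *m u) v.
Proof.
move=> /is_hermitianmxP; rewrite expr0 scale1r => hA u v.
by rewrite /inner trmx_mul map_mxM -mulmxA {1}hA.
Qed.

Lemma selfadjoint_rinner A : selfadjoint A -> forall u v, rinner u (A *m v) = rinner (A *m u) v.
Proof. by move=> hA u v; rewrite /rinner selfadjointP. Qed.

Lemma mulmx_cmul A a v : A *m cmul a v = cmul a (A *m v).
Proof. by rewrite /cmul scalemxAr. Qed.

Lemma cmulA a b v : cmul a (cmul b v) = cmul (a * b) v.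
Proof. by rewrite /cmul scalerA rmorphM. Qed.

Lemma cmulZ (z : R[i]) a v : cmul a (z *: v) = z *: cmul a v.
Proof. by rewrite /cmul !scalerA mulrC. Qed.

Lemma cmulCA a b v : cmul a (cmul b v) = cmul b (cmul a v).
Proof. by rewrite !cmulA mulrC. Qed.

Lemma cmulDr a u v : cmul a (u + v) = cmul a u + cmul a v.
Proof. by rewrite /cmul scalerDr. Qed.

Lemma cmulBr a u v : cmul a (u - v) = cmul a u - cmul a v.
Proof. by rewrite /cmul scalerBr. Qed.

Lemma cmulDl a b v : cmul (a + b) v = cmul a v + cmul b v.
Proof. by rewrite /cmul rmorphD scalerDl. Qed.

Lemma cmul0 v : cmul 0 v = 0.
Proof. by rewrite /cmul rmorph0 scale0r. Qed.

Lemma cmul1 v : cmul 1 v = v.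
Proof. by rewrite /cmul rmorph1 scale1r. Qed.

Lemma cmul_sumr (I : Type) (r : seq I) (P : pred I) a (F : I -> 'cV[R[i]]_n) :
  cmul a (\sum_(i <- r | P i) F i) = \sum_(i <- r | P i) cmul a (F i).
Proof. by rewrite /cmul scaler_sumr. Qed.

Lemma scale_natV (k : nat) v : (k%:R^-1 : R[i]) *: v = cmul k%:R^-1 v.
Proof. by rewrite /cmul fmorphV rmorph_nat. Qed.

Lemma scale_nat (k : nat) v : (k%:R : R[i]) *: v = cmul k%:R v.
Proof. by rewrite /cmul rmorph_nat. Qed.

Lemma mul_cscalar_mx a v : ((a%:C)%C%:M : 'M[R[i]]_n) *m v = cmul a v.
Proof. exact: mul_scalar_mx. Qed.

Lemma expvalE A v : expval A v = rinner v (A *m v). Proof. by []. Qed.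

Lemma inner_sqr v : inner v v = ((vnorm v ^+ 2)%:C)%C.
Proof.
have := innerC v v; rewrite vnorm_sqr /rinner; case: (inner v v) => x y /eqP.
rewrite eq_complex /= => /andP[_ /eqP h]; apply/eqP; rewrite eq_complex /= eqxx /=.
by apply/eqP; lra.
Qed.

Lemma normalizeE v : normalize v = cmul (vnorm v)^-1 v. Proof. by []. Qed.

Lemma vnorm_normalize v : v != 0 -> vnorm (normalize v) = 1.
Proof.
move=> v0; rewrite normalizeE vnormZ ger0_norm ?invr_ge0 ?vnorm_ge0//.
by rewrite mulVf//; apply: contraNneq v0 => /vnorm_eq0 ->.
Qed.

Lemma vnorm_normalize_le1 v : vnorm (normalize v) <= 1.
Proof.
have [->|/vnorm_normalize ->//] := eqVneq v 0.
by rewrite /normalize scaler0 vnorm0.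
Qed.

Section Commutator.
Implicit Types X Y Z : 'M[R[i]]_n.

Lemma commutatorNC X Y : commutator X Y = - commutator Y X.
Proof. by rewrite /commutator opprB. Qed.

Lemma commutatorXX X : commutator X X = 0.
Proof. by rewrite /commutator subrr. Qed.

Lemma commutatorDl X Y Z : commutator (X + Y) Z = commutator X Z + commutator Y Z.
Proof. by rewrite /commutator mulmxDl mulmxDr opprD addrACA. Qed.

Lemma commutatorZl z X Y : commutator (z *: X) Y = z *: commutator X Y.
Proof. by rewrite /commutator -scalemxAl -scalemxAr scalerBr. Qed.

Lemma commutatorDr X Y Z : commutator Z (X + Y) = commutator Z X + commutator Z Y.
Proof. by rewrite commutatorNC commutatorDl opprD -!(commutatorNC Z). Qed.

Lemma commutatorZr z X Y : commutator Y (z *: X) = z *: commutator Y X.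
Proof. by rewrite commutatorNC commutatorZl -scalerN -commutatorNC. Qed.

End Commutator.

End RealInner.

Opaque vnorm rinner cmul.

(** * Ladder operators *)

Section Ladder.
Variable R : realType.

(* In the lattice system [up] and [dn] are the densities of O^+ and O^-, [chg]
   is C and [kap] is 2/V^2, so [up] and [dn] commute in the limit on vectors of
   charge O(V). *)
Record ladder (n : nat) := Ladder {
  up : 'M[R[i]]_n;
  dn : 'M[R[i]]_n;
  chg : 'M[R[i]]_n;
  vac : 'cV[R[i]]_n;
  wt : R;
  kap : R }.

Record is_ladder n (B : R) (T : ladder n) : Prop := IsLadder {
  lad_adj : forall u v, rinner u (up T *m v) = rinner (dn T *m u) v;
  lad_up : forall v : 'cV[R[i]]_n, vnorm (up T *m v) <= B * vnorm v;
  lad_dn : forall v : 'cV[R[i]]_n, vnorm (dn T *m v) <= B * vnorm v;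
  lad_chg : forall u v, rinner u (chg T *m v) = rinner (chg T *m u) v;
  lad_chg_up : forall v : 'cV[R[i]]_n, chg T *m (up T *m v) = up T *m (chg T *m v) + up T *m v;
  lad_chg_dn : forall v : 'cV[R[i]]_n, chg T *m (dn T *m v) = dn T *m (chg T *m v) - dn T *m v;
  lad_comm : forall v : 'cV[R[i]]_n,
    up T *m (dn T *m v) - dn T *m (up T *m v) = cmul (kap T) (chg T *m v);
  lad_vac : chg T *m vac T = cmul (wt T) (vac T);
  lad_norm : vnorm (vac T) = 1 }.

(** Charge conjugation: exchanging the two operators reverses the charge and the sign of their
    commutator, so [kap] is unchanged. *)
Definition ladder_swap n (T : ladder n) : ladder n :=
  Ladder (dn T) (up T) (- chg T) (vac T) (- wt T) (kap T).

Lemma ladder_swapP n B (T : ladder n) : is_ladder B T -> is_ladder B (ladder_swap T).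
Proof.
move=> hT; split; rewrite /ladder_swap; cbn [up dn chg vac wt kap].
- by move=> u v; rewrite rinnerC -(lad_adj hT) rinnerC.
- exact: lad_dn hT.
- exact: lad_up hT.
- by move=> u v; rewrite !mulNmx rinnerNr rinnerNl (lad_chg hT).
- by move=> v; rewrite !mulNmx mulmxN (lad_chg_dn hT) opprB addrC.
- by move=> v; rewrite !mulNmx mulmxN (lad_chg_up hT) opprD.
- by move=> v; rewrite mulNmx -opprB (lad_comm hT) -!cmulN1 !cmulA mulrC.
- by rewrite mulNmx (lad_vac hT) -!cmulN1 cmulA mulN1r.
- exact: lad_norm hT.
Qed.

Section OneLadder.
Variables (n : nat) (B : R) (T : ladder n).
Hypothesis hT : is_ladder B T.
Implicit Types (u v : 'cV[R[i]]_n) (c : R).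

Lemma ladder_bound_ge0 : 0 <= B.
Proof.
apply: le_trans (vnorm_ge0 _) (le_trans (lad_up hT (vac T)) _).
by rewrite (lad_norm hT) mulr1.
Qed.

Definition charged c v := chg T *m v = cmul c v.

Lemma charged_vac : charged (wt T) (vac T). Proof. exact: lad_vac hT. Qed.

Lemma charged_up c v : charged c v -> charged (c + 1) (up T *m v).
Proof. by rewrite /charged (lad_chg_up hT) => ->; rewrite mulmx_cmul cmulDl cmul1. Qed.

Lemma charged_dn c v : charged c v -> charged (c - 1) (dn T *m v).
Proof. by rewrite /charged (lad_chg_dn hT) => ->; rewrite mulmx_cmul cmulDl cmulN1. Qed.

Lemma chargedZ c (z : R[i]) v : charged c v -> charged c (z *: v).
Proof. by rewrite /charged -scalemxAr => ->; rewrite cmulZ. Qed.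

Lemma charged_cmul c a v : charged c v -> charged c (cmul a v).
Proof. exact: chargedZ. Qed.

Lemma chargedD c u v : charged c u -> charged c v -> charged c (u + v).
Proof. by rewrite /charged mulmxDr cmulDr => -> ->. Qed.

Lemma charged_orthogonal c c' u v : c != c' -> charged c u -> charged c' v -> rinner u v = 0.
Proof.
move=> cc' hu hv; have := lad_chg hT u v; rewrite hu hv rinnerZl rinnerZr => /eqP.
rewrite -subr_eq0 -mulrBl mulf_eq0 subr_eq0 eq_sym => /orP[|/eqP//].
by rewrite (negPf cc').
Qed.

(** This is the expectation of the commutator in v: adjointness turns the two products into squared
    norms. *)
Lemma dn_up_norm c v : charged c v ->
  vnorm (dn T *m v) ^+ 2 = vnorm (up T *m v) ^+ 2 + kap T * c * vnorm v ^+ 2.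
Proof.
move=> hv; have e1 := lad_adj hT v (dn T *m v); have e2 := lad_adj hT (up T *m v) v.
have e3 := lad_comm hT v.
rewrite !vnorm_sqr -e1 e2 [X in _ = X + _]rinnerC -(subrK (dn T *m (up T *m v)) (up T *m _)) e3.
by rewrite hv cmulA rinnerDr rinnerZr addrC.
Qed.

(** The normal form of words in the two operators: in the limit only the number of factors of each
    kind matters. *)
Definition mono (j l : nat) := iter j (mulmx (dn T)) (iter l (mulmx (up T)) (vac T)).

Lemma charged_mono j l : charged (wt T + l%:R - j%:R) (mono j l).
Proof.
elim: j => [|j IH]; last by rewrite -natr1 opprD addrA; apply: charged_dn.
rewrite subr0; elim: l => [|l IH]; first by rewrite addr0; apply: charged_vac.
by rewrite -natr1 addrA; apply: charged_up.
Qed.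

Lemma vnorm_mono j l : vnorm (mono j l) <= B ^+ (j + l).
Proof.
have B0 := ladder_bound_ge0; elim: j => [|j IH]; last first.
  by rewrite addSn exprS (le_trans (lad_dn hT _))// ler_wpM2l.
elim: l => [|l IH]; first by rewrite /mono /= (lad_norm hT) expr0.
by rewrite add0n exprS (le_trans (lad_up hT _))// ler_wpM2l.
Qed.

Lemma monoS j l : mono j.+1 l = dn T *m mono j l. Proof. by []. Qed.

Lemma mono0S l : mono 0 l.+1 = up T *m mono 0 l. Proof. by []. Qed.

Lemma mono00 : mono 0 0 = vac T. Proof. by []. Qed.

Lemma mono0 l : mono 0 l = iter l (mulmx (up T)) (vac T). Proof. by []. Qed.

Lemma mono_swap j : mono j 0 = iter j (mulmx (dn T)) (vac T). Proof. by []. Qed.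

Definition sqmom (k : nat) : R := vnorm (mono 0 k) ^+ 2.

Lemma sqmom0 : sqmom 0 = 1. Proof. by rewrite /sqmom /mono /= (lad_norm hT) expr1n. Qed.

Lemma sqmomS_le k : sqmom k.+1 <= B ^+ 2 * sqmom k.
Proof.
have B0 := ladder_bound_ge0.
by rewrite -exprMn ler_pXn2r ?nnegrE ?mulr_ge0 ?vnorm_ge0// (lad_up hT).
Qed.

(* The last factor is asymptotically [sqmom k.+2], see [mono_sqnorm]. *)
Lemma sqmom_convex k : sqmom k.+1 ^+ 2 <= sqmom k * vnorm (mono 1 k.+1) ^+ 2.
Proof.
have e := lad_adj hT (mono 0 k.+1) (mono 0 k).
have h : sqmom k.+1 <= vnorm (mono 0 k) * vnorm (mono 1 k.+1).
  by rewrite /sqmom vnorm_sqr e mulrC (le_trans (ler_norm _))// cauchy_schwarz.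
rewrite {2}/sqmom -exprMn; apply: lerXn2r h; rewrite nnegrE ?mulr_ge0 ?vnorm_ge0//.
Qed.

End OneLadder.
End Ladder.

Opaque mono.

(** * Families of vectors indexed by the size *)

Section Families.
Variable R : realType.

Lemma seq_cvgD (a b : nat -> R) (la lb : R) :
  a j @[j --> \oo] --> la -> b j @[j --> \oo] --> lb -> (a j + b j) @[j --> \oo] --> la + lb.
Proof. exact: cvgD. Qed.

Lemma seq_cvgM (a b : nat -> R) (la lb : R) :
  a j @[j --> \oo] --> la -> b j @[j --> \oo] --> lb -> (a j * b j) @[j --> \oo] --> la * lb.
Proof. exact: cvgM. Qed.

Lemma seq_cvgMl (c : R) (a : nat -> R) (l : R) :
  a j @[j --> \oo] --> l -> (c * a j) @[j --> \oo] --> c * l.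
Proof. by move=> al; apply: seq_cvgM => //; exact: cvg_cst. Qed.

Lemma seq_cvg_sum0 (I : Type) (r : seq I) (F : I -> nat -> R) :
  (forall i, F i j @[j --> \oo] --> 0) -> (\sum_(i <- r) F i j) @[j --> \oo] --> 0.
Proof.
move=> F0; elim: r => [|i r IH].
  by under eq_fun do rewrite big_nil; exact: cvg_cst.
under eq_fun do rewrite big_cons.
by have := seq_cvgD (F0 i) IH; rewrite addr0.
Qed.

Lemma seq_cvg_norm0 (a : nat -> R) : a j @[j --> \oo] --> 0 -> `|a j| @[j --> \oo] --> 0.
Proof. by move=> a0; rewrite -[in X in _ --> X](@normr0 _ R); apply: cvg_norm. Qed.

Lemma cvg0_le (a b : nat -> R) :
  (forall j, `|a j| <= b j) -> b j @[j --> \oo] --> 0 -> a j @[j --> \oo] --> 0.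
Proof.
move=> ab b0; apply: norm_cvg0; apply: (squeeze_cvgr _ (cvg_cst 0) b0).
by apply: nearW => j; rewrite normr_ge0 ab.
Qed.

Lemma cvg_sub_trans (a b c : nat -> R) :
  (a j - b j) @[j --> \oo] --> 0 -> (b j - c j) @[j --> \oo] --> 0 ->
  (a j - c j) @[j --> \oo] --> 0.
Proof.
move=> ab bc; rewrite -[0]addr0.
have -> : (fun j => a j - c j) = (fun j => (a j - b j) + (b j - c j)).
  by apply/funext => j; rewrite addrA subrK.
exact: cvgD.
Qed.

Lemma cvg_sub_sym (a b : nat -> R) :
  (a j - b j) @[j --> \oo] --> 0 -> (b j - a j) @[j --> \oo] --> 0.
Proof.
move=> ab; rewrite -oppr0.
have -> : (fun j => b j - a j) = (fun j => - (a j - b j)).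
  by apply/funext => j; rewrite opprB.
exact: cvgN.
Qed.

Lemma cvg_sub_cvg (a b : nat -> R) (l : R) :
  (a j - b j) @[j --> \oo] --> 0 -> b j @[j --> \oo] --> l -> a j @[j --> \oo] --> l.
Proof.
move=> ab bl; rewrite -[l]add0r.
have -> : a = (fun j => (a j - b j) + b j) by apply/funext => j; rewrite subrK.
exact: cvgD.
Qed.

Section Vclose.
Variable dim : nat -> nat.
Implicit Types x y z : forall j, 'cV[R[i]]_(dim j).

(** The space changes with j, so there is no limit vector; families can only be compared with one
    another. *)
Definition vclose x y := vnorm (x j - y j) @[j --> \oo] --> (0 : R).

Lemma vclose_eq x y : (forall j, x j = y j) -> vclose x y.
Proof.
move=> xy; rewrite /vclose; under eq_fun do rewrite xy subrr vnorm0.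
exact: cvg_cst.
Qed.

Lemma vclose_refl x : vclose x x. Proof. exact: vclose_eq. Qed.

Lemma vclose_le x y (b : nat -> R) :
  (forall j, vnorm (x j - y j) <= b j) -> b j @[j --> \oo] --> 0 -> vclose x y.
Proof. by move=> xy; apply: cvg0_le => j; rewrite ger0_norm ?vnorm_ge0. Qed.

Lemma vclose_trans y x z : vclose x y -> vclose y z -> vclose x z.
Proof.
move=> xy yz; have := seq_cvgD xy yz; rewrite addr0 => h0; apply: (vclose_le _ h0) => j /=.
by have := vnormD (x j - y j) (y j - z j); rewrite addrA subrK.
Qed.

Lemma vcloseD x y x' y' : vclose x y -> vclose x' y' ->
  vclose (fun j => x j + x' j) (fun j => y j + y' j).
Proof.
move=> xy xy'; have := seq_cvgD xy xy'; rewrite addr0 => h0; apply: (vclose_le _ h0) => j /=.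
by rewrite opprD addrACA vnormD.
Qed.

Lemma vclose_mul (A : forall j, 'M[R[i]]_(dim j)) (B : R) x y :
  (forall j v, vnorm (A j *m v) <= B * vnorm v) ->
  vclose x y -> vclose (fun j => A j *m x j) (fun j => A j *m y j).
Proof.
move=> AB xy; have := seq_cvgMl (c := B) xy; rewrite mulr0 => h0; apply: (vclose_le _ h0) => j /=.
by rewrite -mulmxBr.
Qed.

Lemma vclose_cmul (a : R) x y :
  vclose x y -> vclose (fun j => cmul a (x j)) (fun j => cmul a (y j)).
Proof.
move=> xy; have := seq_cvgMl (c := `|a|) xy; rewrite mulr0 => h0; apply: (vclose_le _ h0) => j /=.
by rewrite -cmulBr vnormZ.
Qed.

Lemma vclose_sum (I : Type) (r : seq I) (F G : I -> forall j, 'cV[R[i]]_(dim j)) :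
  (forall i, vclose (F i) (G i)) ->
  vclose (fun j => \sum_(i <- r) F i j) (fun j => \sum_(i <- r) G i j).
Proof.
move=> FG; elim: r => [|i r IH].
  rewrite /vclose; under eq_fun do rewrite !big_nil subrr vnorm0.
  exact: cvg_cst.
rewrite /vclose; under eq_fun do rewrite !big_cons.
exact: (vcloseD (FG i) IH).
Qed.

(** The difference of squares is the product of the difference and the sum of the norms. A bound on
    y controls the sum, since x stays within [vnorm (x j - y j)] of y. *)
Lemma vclose_sqnorm x y (K : R) : (forall j, vnorm (y j) <= K) -> vclose x y ->
  (vnorm (x j) ^+ 2 - vnorm (y j) ^+ 2) @[j --> \oo] --> 0.
Proof.
move=> yK xy; have cst c : (fun=> c : R) j @[j --> \oo] --> c by exact: cvg_cst.
have := seq_cvgM xy (seq_cvgD xy (cst (K + K))); rewrite mul0r.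
move=> h0; apply: (cvg0_le _ h0) => j /=.
rewrite subr_sqr normrM ler_pM ?normr_ge0 ?ler_vnorm_dist//.
rewrite ger0_norm ?addr_ge0 ?vnorm_ge0//.
have := vnormD (x j - y j) (y j); rewrite subrK => h.
rewrite /= addrA lerD// (le_trans h)// lerD//.
Qed.

Lemma vclose_rinner x y (w : forall j, 'cV[R[i]]_(dim j)) (K : R) :
  (forall j, vnorm (w j) <= K) -> vclose x y ->
  (rinner (w j) (x j) - rinner (w j) (y j)) @[j --> \oo] --> 0.
Proof.
move=> wK xy; have := seq_cvgMl (c := K) xy; rewrite mulr0 => h0; apply: (cvg0_le _ h0) => j /=.
rewrite -rinnerNr -rinnerDr (le_trans (cauchy_schwarz _ _))//.
by rewrite ler_wpM2r ?vnorm_ge0.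
Qed.

End Vclose.

Section LadderFamily.
Variables (dim : nat -> nat) (B : R) (T : forall j, ladder R (dim j)).
Hypotheses (hT : forall j, is_ladder B (T j)).
Hypotheses (kap0 : kap (T j) @[j --> \oo] --> 0).
Hypotheses (kapwt0 : (kap (T j) * wt (T j)) @[j --> \oo] --> 0).

Lemma kap_charge_cvg0 (t : R) : (kap (T j) * (wt (T j) + t)) @[j --> \oo] --> 0.
Proof.
have h := seq_cvgD kapwt0 (seq_cvgMl (c := t) kap0); rewrite mulr0 addr0 in h.
by under eq_fun do rewrite mulrDr [X in _ + X]mulrC.
Qed.

Lemma up_dn_close (x : forall j, 'cV[R[i]]_(dim j)) (t K : R) :
  (forall j, charged (T j) (wt (T j) + t) (x j)) -> (forall j, vnorm (x j) <= K) ->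
  vclose (fun j => up (T j) *m (dn (T j) *m x j)) (fun j => dn (T j) *m (up (T j) *m x j)).
Proof.
move=> xc xK; have h := seq_cvg_norm0 (kap_charge_cvg0 t).
have := seq_cvgMl (c := (K)) h; rewrite mulr0 => h0; apply: (vclose_le _ h0) => j /=.
by rewrite (lad_comm (hT j)) xc cmulA vnormZ mulrC ler_wpM2r.
Qed.

(** The raising factor passes the k lowering factors one at a time. Each exchange costs a
    commutator, which on a vector of definite charge is a scalar tending to 0, and the factors left
    outside are bounded. *)
Lemma up_mono_close k l :
  vclose (fun j => up (T j) *m mono (T j) k l) (fun j => mono (T j) k l.+1).
Proof.
elim: k => [|k IH]; first by apply: vclose_eq => j; rewrite mono0S.
apply: (@vclose_trans _ (fun j => dn (T j) *m mono (T j) k l.+1)); last first.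
  by apply: vclose_eq => j; rewrite monoS.
apply: vclose_trans (vclose_mul (fun j => lad_dn (hT j)) IH).
apply: (@vclose_trans _ (fun j => up (T j) *m (dn (T j) *m mono (T j) k l))).
  by apply: vclose_eq => j; rewrite monoS.
apply: (@up_dn_close _ (l%:R - k%:R) (B ^+ (k + l))) => j.
  by rewrite addrA; apply: charged_mono (hT j) _ _.
exact: vnorm_mono (hT j) _ _.
Qed.

(** Lowering factors are traded for raising ones one by one: [dn_up_norm] makes dn w and up w
    asymptotically equal in norm, and [up_mono_close] restores the normal order. *)
Lemma mono_sqnorm k l :
  (vnorm (mono (T j) k l) ^+ 2 - sqmom (T j) (k + l)) @[j --> \oo] --> 0.
Proof.
elim: k l => [|k IH] l.
  by under eq_fun do rewrite subrr; apply: cvg_cst.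
rewrite addSnnS; apply: cvg_sub_trans (IH l.+1).
apply: cvg_sub_trans (vclose_sqnorm (fun j => vnorm_mono (hT j) k l.+1) (up_mono_close k l)).
have h := seq_cvg_norm0 (kap_charge_cvg0 (l%:R - k%:R)).
have := seq_cvgMl (c := (B ^+ (k + l)) ^+ 2) h; rewrite mulr0 => h0; apply: (cvg0_le _ h0) => j.
rewrite monoS.
have e := dn_up_norm (hT j) (charged_mono (hT j) k l).
rewrite e.
rewrite addrAC subrr add0r -addrA normrM mulrC.
apply: ler_wpM2r; first exact: normr_ge0.
rewrite ger0_norm ?sqr_ge0//.
by rewrite ler_pXn2r ?nnegrE ?vnorm_ge0 ?exprn_ge0 ?(ladder_bound_ge0 (hT j))// (vnorm_mono (hT j)).
Qed.

(* The binomial expansion of (up + e dn)^k vac, as if [up] and [dn] commuted. *)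
Definition binomial_vec (e : R) (k : nat) j :=
  \sum_(0 <= i < k.+1) cmul ('C(k, i)%:R * e ^+ i) (mono (T j) i (k - i)).

Lemma binomial_vecS e k j :
  binomial_vec e k.+1 j =
  \sum_(0 <= i < k.+1) cmul ('C(k, i)%:R * e ^+ i) (mono (T j) i (k - i).+1 +
    cmul e (dn (T j) *m mono (T j) i (k - i))).
Proof.
under [RHS]eq_big_nat => i /andP[_ ik].
  rewrite cmulDr cmulA -subSn// -monoS -mulrA -exprSr.
  rewrite -(subSS i k).
  over.
rewrite big_split /= -/(binomial_vec e k.+1 j).
pose F i := mono (T j) i (k.+1 - i).
rewrite [LHS]big_nat_recl//.
(* The term k + 1 added at the end is zero because 'C(k, k.+1) = 0; both sums then run over the same
   indices and Pascal's rule applies termwise. *)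
have -> : \sum_(0 <= i < k.+1) cmul ('C(k, i)%:R * e ^+ i) (F i) =
   cmul 1 (F 0%N) + \sum_(0 <= i < k.+1) cmul ('C(k, i.+1)%:R * e ^+ i.+1) (F i.+1).
  rewrite [in RHS]big_nat_recr//= bin_small// mul0r cmul0 addr0.
  have c0 : 'C(k, 0)%:R * e ^+ 0 = 1 by rewrite bin0 expr0 mulr1.
  by rewrite [LHS]big_nat_recl; [rewrite c0|].
rewrite bin0 expr0 mulr1 -addrA -big_split /=; congr (_ + _).
by apply: eq_bigr => i _; rewrite binS natrD mulrDl cmulDl.
Qed.

Lemma binomial_close (e : R) k :
  vclose (fun j => iter k (fun v => up (T j) *m v + cmul e (dn (T j) *m v)) (vac (T j)))
         (binomial_vec e k).
Proof.
elim: k => [|k IH].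
  rewrite /vclose; under eq_fun do
    rewrite /binomial_vec big_nat1 mono00 bin0 expr0 mulr1 cmul1 subrr vnorm0.
  exact: cvg_cst.
apply: (@vclose_trans _ (fun j => up (T j) *m binomial_vec e k j +
                                  cmul e (dn (T j) *m binomial_vec e k j))).
  apply: vcloseD; first exact: vclose_mul (fun j => lad_up (hT j)) IH.
  by apply: vclose_cmul; apply: vclose_mul (fun j => lad_dn (hT j)) IH.
rewrite /vclose; under eq_fun => j.
  rewrite binomial_vecS /binomial_vec !mulmx_sumr cmul_sumr -big_split /=.
  under eq_bigr => i _ do rewrite !mulmx_cmul cmulCA -cmulDr.
  over.
apply: vclose_sum => i; apply: vclose_cmul; apply: vcloseD; last exact: vclose_refl.
exact: up_mono_close.
Qed.

(** The i-th monomial has charge wt + k - 2 i, so the terms are orthogonal. *)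
Lemma binomial_sqnorm (e : R) k j : e ^+ 2 = 1 ->
  vnorm (binomial_vec e k j) ^+ 2 =
  \sum_(0 <= i < k.+1) ('C(k, i)%:R) ^+ 2 * vnorm (mono (T j) i (k - i)) ^+ 2.
Proof.
move=> e2; rewrite pythagoras ?iota_uniq//.
  apply: eq_bigr => i _; rewrite vnormZ exprMn real_normK ?num_real// exprMn.
  by rewrite exprAC e2 expr1n mulr1.
move=> i i' ii'; wlog lt_ii' : i i' ii' / (i < i')%N.
  move=> H; have [lt|gt] := ltnP i i'; first exact: H.
  by rewrite rinnerC; apply: H; rewrite 1?eq_sym// ltn_neqAle eq_sym ii'.
(* [pythagoras] asks for orthogonality at all indices. Above k the subtraction k - i' is truncated
   and the charge is no longer the expected one, but the coefficient vanishes. *)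
have [ki'|ik] := ltnP k i'.
  by rewrite [X in cmul (X%:R * _) (mono _ i' _)]bin_small// mul0r cmul0 rinner0r.
apply: (charged_orthogonal (hT j)); last 2 first.
  by apply: charged_cmul; apply: charged_mono (hT j) _ _.
  by apply: charged_cmul; apply: charged_mono (hT j) _ _.
have : (i%:R : R) < i'%:R by rewrite ltr_nat.
rewrite !natrB; [|lia..]; move=> ?; apply/eqP => ?; lra.
Qed.

End LadderFamily.
End Families.

(** * Log-convex moment sequences *)

Section RatioTest.
Variable R : realType.
Implicit Types (t S : nat -> R) (l : R).

Lemma seq_cvgV (a : nat -> R) l : l != 0 ->
  a j @[j --> \oo] --> l -> (a j)^-1 @[j --> \oo] --> l^-1.
Proof. by move=> l0 al; exact: cvgV. Qed.

Lemma seq_cvg_sqrt (a : nat -> R) l :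
  a j @[j --> \oo] --> l -> Num.sqrt (a j) @[j --> \oo] --> Num.sqrt l.
Proof. by move=> al; apply: continuous_cvg => //; apply: sqrt_continuous. Qed.

Lemma seq_cvgX (a : nat -> R) l k :
  a j @[j --> \oo] --> l -> (a j) ^+ k @[j --> \oo] --> l ^+ k.
Proof. by move=> al; apply: (continuous_cvg _ (@exprn_continuous R k l) al). Qed.

(** ln t_n is a telescoping sum of log-ratios, so the 2n-th root is the exponential of half their
    Cesaro mean. *)
Lemma root_cvg_ratio t l : t 0%N = 1 -> (forall k, 0 < t k) -> 0 < l ->
  (t k.+1 / t k) @[k --> \oo] --> l ->
  (t k) `^ (k.*2%:R)^-1 @[k --> \oo] --> Num.sqrt l.
Proof.
(* The shift matches [arithmetic_mean], whose n-th value averages n + 1 terms. *)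
move=> t0 t_gt0 l_gt0 tl; rewrite -(cvg_shiftS (fun k => t k `^ (k.*2%:R)^-1)) /=.
have lnl : ln (t k.+1 / t k) @[k --> \oo] --> ln l.
  by apply: continuous_cvg => //; exact: continuous_ln.
have sumln n : \sum_(0 <= k < n) ln (t k.+1 / t k) = ln (t n).
  elim: n => [|n IH]; first by rewrite big_nil t0 ln1.
  by rewrite big_nat_recr//= IH ln_div ?posrE// addrC subrK.
have mean : (n.+1%:R^-1 * ln (t n.+1)) @[n --> \oo] --> ln l.
  have := cesaro lnl; rewrite /arithmetic_mean.
  by under eq_fun do rewrite /series /= sumln.
rewrite -powR12_sqrt ?ltW// /powR (gt_eqF l_gt0).
have -> : (fun n => if t n.+1 == 0 then ((n.+1.*2%:R)^-1 == 0 :> R)%:R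
     else expR ((n.+1.*2)%:R^-1 * ln (t n.+1))) =
   (fun n => expR (2^-1 * (n.+1%:R^-1 * ln (t n.+1)))).
  apply/funext => n; rewrite (gt_eqF (t_gt0 _)) mulrA -invfM -natrM mul2n//.
apply: continuous_cvg; first exact: continuous_expR.
exact: seq_cvgMl.
Qed.

(* The mean of cos^(2k) over a uniform angle. *)
Definition arcsine_moment (k : nat) : R := 'C(k.*2, k)%:R / 4 ^+ k.

Lemma arcsine_moment_gt0 k : 0 < arcsine_moment k.
Proof. by rewrite divr_gt0 ?exprn_gt0// ltr0n bin_gt0 -addnn leq_addl. Qed.

(** The ratio of consecutive values tends to 1, so this factor does not affect the limit of the
    roots. *)
Lemma arcsine_momentS k :
  arcsine_moment k.+1 = (1 - 2^-1 * k.+1%:R^-1) * arcsine_moment k.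
Proof.
have e : (k.+1 * 'C(k.+1.*2, k.+1) = 2 * (k.*2.+1 * 'C(k.*2, k)))%N.
  have e1 := mul_bin_diag k.+1.*2 k; have e2 := mul_bin_diag k.*2.+1 k.
  have e3 : 'C(k.*2.+1, k) = 'C(k.*2.+1, k.+1).
    by rewrite -bin_sub; [congr ('C(_, _)); lia|lia].
  move: e1 e2; rewrite doubleS /= e3; nia.
have e' : k.+1%:R * 'C(k.+1.*2, k.+1)%:R = 2 * ((k.*2%:R + 1) * 'C(k.*2, k)%:R) :> R.
  by rewrite natr1 -!natrM e.
have k0 : k.+1%:R != 0 :> R by rewrite pnatr_eq0.
have p0 : 4 ^+ k != 0 :> R by rewrite expf_neq0// pnatr_eq0.
have kS : k.+1%:R = k%:R + 1 :> R by rewrite natr1.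
apply: (mulfI k0); rewrite /arcsine_moment mulrA e' exprS -muln2 natrM kS in k0 *.
by move: (4 ^+ k) p0 => P p0; field; rewrite k0 p0.
Qed.

Section LogConvex.
Variables (S : nat -> R) (K : R).
Hypotheses (S0 : S 0%N = 1) (S1 : 0 < S 1%N).
Hypothesis convexS : forall k, S k.+1 ^+ 2 <= S k * S k.+2.
Hypothesis boundS : forall k, S k.+1 <= K * S k.

Lemma logconvex_gt0 k : 0 < S k.
Proof.
suff [] : 0 < S k /\ 0 < S k.+1 by [].
elim: k => [|k [h1 h2]]; first by rewrite S0.
split=> //; rewrite -(pmulr_rgt0 _ h1).
by apply: lt_le_trans (convexS k); rewrite exprn_gt0.
Qed.

(** The ratios increase, [K] bounds them from above, and the first one, S 1 > 0, bounds the limit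
    from below. *)
Lemma logconvex_ratio_cvg : exists2 l : R, 0 < l & (S k.+1 / S k) @[k --> \oo] --> l.
Proof.
have gt0 := logconvex_gt0.
have mono : {homo (fun k => S k.+1 / S k) : n m / (n <= m)%N >-> n <= m}.
  apply/nondecreasing_seqP => k; rewrite ler_pdivrMr// mulrAC ler_pdivlMr//.
  by rewrite -expr2 mulrC convexS.
have bnd : has_ubound (range (fun k => S k.+1 / S k)).
  by exists K => _ [k _ <-]; rewrite ler_pdivrMr.
have cv := nondecreasing_is_cvgn mono bnd; exists (limn (fun k => S k.+1 / S k)) => //.
apply: lt_le_trans S1 _.
have := nondecreasing_cvgn_le mono cv 0%N; by rewrite S0 divr1.
Qed.

Lemma logconvex_root l : 0 < l -> (S k.+1 / S k) @[k --> \oo] --> l ->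
  (arcsine_moment k * S k) `^ (k.*2%:R)^-1 @[k --> \oo] --> Num.sqrt l.
Proof.
move=> l_gt0 Sl; apply: root_cvg_ratio => //.
- by rewrite S0 /arcsine_moment bin0 expr0 divr1 mulr1.
- by move=> k; rewrite mulr_gt0 ?arcsine_moment_gt0 ?logconvex_gt0.
have -> : (fun k => arcsine_moment k.+1 * S k.+1 / (arcsine_moment k * S k)) =
    (fun k => (1 + - 2^-1 * harmonic k) * (S k.+1 / S k)).
  apply/funext => k; rewrite arcsine_momentS /harmonic /= mulNr.
  have a0 := lt0r_neq0 (arcsine_moment_gt0 k); have s0 := lt0r_neq0 (logconvex_gt0 k).
  have k0 : k.+1%:R != 0 :> R by rewrite pnatr_eq0.
  have kS : k.+1%:R = k%:R + 1 :> R by rewrite natr1.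
  by rewrite kS in k0 *; field; rewrite k0 a0 s0.
rewrite -[l]mul1r; apply: seq_cvgM => //.
have h1 : (fun=> 1 : R) k @[k --> \oo] --> (1 : R) by exact: cvg_cst.
have := seq_cvgD h1 (seq_cvgMl (c := - 2^-1) (@cvg_harmonic R)).
by rewrite mulr0 addr0.
Qed.

End LogConvex.
End RatioTest.

(** * Towers of states *)

Section TowerVectors.
Variable R : realType.
Variables (n : nat) (B : R) (T : ladder R n).
Hypothesis hT : is_ladder B T.

Definition tower (k : nat) := normalize (mono T 0 k).

Lemma tower_normalize k : tower k = normalize (mono T 0 k). Proof. by []. Qed.

(** [up_err] and [dn_err] of index k belong to the same rung, the one between the heights k and k +
    1. *)
Definition up_err (m : R) k := vnorm (up T *m tower k - cmul m (tower k.+1)) ^+ 2.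

Definition dn_err (m : R) k := vnorm (dn T *m tower k.+1 - cmul m (tower k)) ^+ 2.

Lemma towerE k : tower k = cmul (Num.sqrt (sqmom T k))^-1 (mono T 0 k).
Proof. by rewrite /sqmom sqrtr_sqr ger0_norm ?vnorm_ge0. Qed.

Lemma up_errE m k : up_err m k =
  ((Num.sqrt (sqmom T k))^-1 - m * (Num.sqrt (sqmom T k.+1))^-1) ^+ 2 * sqmom T k.+1.
Proof.
rewrite /up_err !towerE mulmx_cmul -mono0S cmulA -cmulN1 cmulA -cmulDl vnormZ exprMn.
by rewrite real_normK ?num_real// mulN1r.
Qed.

(** Raising a tower state gives a multiple of the next one, but lowering need not give a multiple of
    the previous one. The square is therefore expanded, with a cross term computed by
    adjointness. *)
Lemma dn_errE m k : dn_err m k =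
  (Num.sqrt (sqmom T k.+1))^-1 ^+ 2 * vnorm (mono T 1 k.+1) ^+ 2
  - 2 * m * (Num.sqrt (sqmom T k.+1))^-1 * (Num.sqrt (sqmom T k))^-1 * sqmom T k.+1
  + m ^+ 2 * (Num.sqrt (sqmom T k))^-1 ^+ 2 * sqmom T k.
Proof.
rewrite /dn_err !towerE mulmx_cmul -monoS cmulA.
set a := (Num.sqrt (sqmom T k.+1))^-1; set b := (Num.sqrt (sqmom T k))^-1.
have e : rinner (mono T 1 k.+1) (mono T 0 k) = sqmom T k.+1.
  by rewrite monoS -(lad_adj hT) -mono0S /sqmom vnorm_sqr.
rewrite vnorm_sqr !(rinnerDr, rinnerDl, rinnerNr, rinnerNl, rinnerZr, rinnerZl).
rewrite (rinnerC (mono T 0 k) (mono T 1 k.+1)) e -!vnorm_sqr -/(sqmom T k).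
move: (sqmom T k) (sqmom T k.+1) (vnorm _ ^+ 2) => x y z; ring.
Qed.

End TowerVectors.

Section TowerLimits.
Variable R : realType.
Variables (dim : nat -> nat) (B : R) (T : forall j, ladder R (dim j)) (S : nat -> R).
Hypotheses (hT : forall j, is_ladder B (T j)).
Hypotheses (kap0 : kap (T j) @[j --> \oo] --> 0).
Hypotheses (kapwt0 : (kap (T j) * wt (T j)) @[j --> \oo] --> 0).
Hypothesis hS : forall k, sqmom (T j) k @[j --> \oo] --> S k.
Arguments hS : clear implicits.

Lemma seq_cvg_uniq (a : nat -> R) (l l' : R) :
  a j @[j --> \oo] --> l -> a j @[j --> \oo] --> l' -> l = l'.
Proof. by move=> h1 h2; apply: (cvg_unique _ h1 h2); exact: norm_hausdorff. Qed.

Lemma lim_sqmom0 : S 0%N = 1.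
Proof.
apply: (seq_cvg_uniq (hS 0%N)).
by under eq_fun do rewrite (sqmom0 (hT _)); exact: cvg_cst.
Qed.

Lemma lim_mono k l : vnorm (mono (T j) k l) ^+ 2 @[j --> \oo] --> S (k + l)%N.
Proof. exact: cvg_sub_cvg (mono_sqnorm hT kap0 kapwt0 k l) (hS _). Qed.

Lemma lim_sqmom_convex k : S k.+1 ^+ 2 <= S k * S k.+2.
Proof.
have h1 := seq_cvgX (k := 2) (hS k.+1); have h2 := seq_cvgM (hS k) (@lim_mono 1 k.+1).
refine (ler_cvg_to h1 h2 _).
by apply: nearW => j; exact: sqmom_convex (hT j) k.
Qed.

Lemma lim_sqmomS_le k : S k.+1 <= B ^+ 2 * S k.
Proof.
refine (ler_cvg_to (hS k.+1) (seq_cvgMl (c := B ^+ 2) (hS k)) _).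
by apply: nearW => j; exact: sqmomS_le (hT j) k.
Qed.

Definition up_err_lim (m : R) k :=
  ((Num.sqrt (S k))^-1 - m * (Num.sqrt (S k.+1))^-1) ^+ 2 * S k.+1.

(** The formula of [dn_errE] in the limit, where the squared norm of [mono T 1 k.+1] has become
    [S k.+2]. *)
Definition dn_err_lim (m : R) k :=
  (Num.sqrt (S k.+1))^-1 ^+ 2 * S k.+2
  - 2 * m * (Num.sqrt (S k.+1))^-1 * (Num.sqrt (S k))^-1 * S k.+1
  + m ^+ 2 * (Num.sqrt (S k))^-1 ^+ 2 * S k.

Hypothesis S1 : 0 < S 1%N.

Let S_gt0 := logconvex_gt0 lim_sqmom0 S1 lim_sqmom_convex.

Let sqrtV_cvg k : (Num.sqrt (sqmom (T j) k))^-1 @[j --> \oo] --> (Num.sqrt (S k))^-1.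
Proof. by apply: seq_cvgV; [rewrite gt_eqF ?sqrtr_gt0|exact: seq_cvg_sqrt]. Qed.

Lemma up_err_cvg m k : up_err (T j) m k @[j --> \oo] --> up_err_lim m k.
Proof.
under eq_fun do rewrite up_errE.
by apply: seq_cvgM => //; apply: seq_cvgX; apply: cvgB => //; apply: seq_cvgMl.
Qed.

Lemma dn_err_cvg m k : dn_err (T j) m k @[j --> \oo] --> dn_err_lim m k.
Proof.
under eq_fun do rewrite (dn_errE (hT _)).
apply: seq_cvgD; last by apply: seq_cvgM => //; apply: seq_cvgMl; apply: seq_cvgX.
apply: cvgB; first by apply: seq_cvgM; [exact: seq_cvgX|exact: lim_mono].
by apply: seq_cvgM => //; apply: seq_cvgM => //; apply: seq_cvgMl.
Qed.

Lemma up_err_lim_cvg0 (m : R) : 0 <= m -> (S k.+1 / S k) @[k --> \oo] --> m ^+ 2 ->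
  up_err_lim m k @[k --> \oo] --> 0.
Proof.
move=> m0 Sm; have sm := seq_cvg_sqrt Sm; rewrite sqrtr_sqr ger0_norm// in sm.
have -> : up_err_lim m = (fun k => (Num.sqrt (S k.+1 / S k) - m) ^+ 2).
  apply/funext => k; rewrite /up_err_lim -{2}[S k.+1]sqr_sqrtr ?ltW// -exprMn.
  rewrite sqrtrM ?ltW// sqrtrV ?ltW//.
  have : Num.sqrt (S k.+1) != 0 by rewrite gt_eqF ?sqrtr_gt0.
  move: (Num.sqrt (S k)) (Num.sqrt (S k.+1)) => x y y0.
  by rewrite mulrBl mulrC -mulrA mulVf// mulr1.
have e : (m - m) ^+ 2 = 0 by rewrite subrr expr0n.
by rewrite -[X in _ --> X]e; apply: seq_cvgX; apply: cvgB => //; exact: cvg_cst.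
Qed.

Lemma dn_err_lim_cvg0 (m : R) : 0 <= m -> (S k.+1 / S k) @[k --> \oo] --> m ^+ 2 ->
  dn_err_lim m k @[k --> \oo] --> 0.
Proof.
move=> m0 Sm; have sm := seq_cvg_sqrt Sm; rewrite sqrtr_sqr ger0_norm// in sm.
have Sm' : (S k.+2 / S k.+1) @[k --> \oo] --> m ^+ 2.
  by have := Sm; rewrite -(cvg_shiftS (fun k => S k.+1 / S k)).
have -> : dn_err_lim m =
    (fun k => S k.+2 / S k.+1 + (- (2 * m)) * Num.sqrt (S k.+1 / S k) + m ^+ 2).
  apply/funext => k; rewrite /dn_err_lim.
  rewrite sqrtrM ?ltW// sqrtrV ?ltW//.
  have h i : Num.sqrt (S i) != 0 by rewrite gt_eqF ?sqrtr_gt0.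
  rewrite -[S k]sqr_sqrtr ?ltW// -[S k.+1]sqr_sqrtr ?ltW//.
  rewrite ![Num.sqrt (_ ^+ 2)]sqrtr_sqr !ger0_norm ?sqrtr_ge0//.
  move: (h k) (h k.+1).
  by move: (Num.sqrt (S k)) (Num.sqrt (S k.+1)) (S k.+2) => x y z x0 y0; field; rewrite x0 y0.
have e : m ^+ 2 + (- (2 * m)) * m + m ^+ 2 = 0 by ring.
rewrite -[X in _ --> X]e; apply: seq_cvgD; last exact: cvg_cst.
by apply: seq_cvgD => //; apply: seq_cvgMl.
Qed.

End TowerLimits.

(** * Even moments of the order operators *)

Section MomentLimits.
Variable R : realType.
Variables (dim : nat -> nat) (B : R) (T : forall j, ladder R (dim j)).
Hypotheses (hT : forall j, is_ladder B (T j)).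
Hypotheses (kap0 : kap (T j) @[j --> \oo] --> 0).
Hypotheses (kapwt0 : (kap (T j) * wt (T j)) @[j --> \oo] --> 0).

(** For e = 1 and e = -1 this is, up to a phase, 2^k times the k-th power of O^(1)/V and O^(2)/V
    applied to the ground state. *)
Definition quad_iter n (L : ladder R n) (e : R) k :=
  iter k (fun v => up L *m v + cmul e (dn L *m v)) (vac L).

Lemma sum_binomial_sqr k : (\sum_(0 <= i < k.+1) 'C(k, i) ^ 2 = 'C(k.*2, k))%N.
Proof.
rewrite -addnn -binomial.Vandermonde big_mkord; apply: eq_bigr => i _.
by rewrite bin_sub ?mulnn// -ltnS.
Qed.

(** The monomials in the expansion are orthogonal and all have asymptotically the squared norm
    [sqmom (T j) k]; the squared binomial coefficients add up to the central one. *)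
Lemma quad_moment_sqmom (e : R) k : e ^+ 2 = 1 ->
  (vnorm (quad_iter (T j) e k) ^+ 2 - 'C(k.*2, k)%:R * sqmom (T j) k) @[j --> \oo] --> 0.
Proof.
move=> e2; pose K := \sum_(0 <= i < k.+1) `|'C(k, i)%:R * e ^+ i| * B ^+ k.
have bK j : vnorm (binomial_vec T e k j) <= K.
  rewrite (le_trans (vnorm_sum _ _ _))// big_seq [leRHS]big_seq ler_sum// => i.
  rewrite mem_index_iota => /andP[_ ik]; rewrite vnormZ ler_wpM2l//.
  by have := vnorm_mono (hT j) i (k - i); rewrite subnKC.
apply: cvg_sub_trans (vclose_sqnorm bK (binomial_close hT kap0 kapwt0 e k)) _.
have -> : (fun j => vnorm (binomial_vec T e k j) ^+ 2 - 'C(k.*2, k)%:R * sqmom (T j) k) =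
   (fun j => \sum_(0 <= i < k.+1)
      ('C(k, i)%:R) ^+ 2 * (vnorm (mono (T j) i (k - i)) ^+ 2 - sqmom (T j) (i + (k - i)))).
  apply/funext => j; rewrite (binomial_sqnorm hT)// -sum_binomial_sqr natr_sum mulr_suml.
  by rewrite -sumrB; apply: eq_big_nat => i /andP[_ ik]; rewrite mulrBr natrX subnKC.
apply: seq_cvg_sum0 => i; rewrite -[X in _ --> X](mulr0 ('C(k, i)%:R ^+ 2)); apply: seq_cvgMl.
exact: mono_sqnorm hT kap0 kapwt0 _ _.
Qed.


End MomentLimits.

(** * Superpositions of the states of a tower *)

Section TowerSuperposition.
Variable R : realType.

Lemma charged_swap n (T : ladder R n) c v : charged (ladder_swap T) c v -> charged T (- c) v.
Proof.
rewrite /charged /= mulNmx => /(congr1 (cmul (- 1))).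
by rewrite cmulN1 opprK cmulA mulN1r.
Qed.

Lemma charged_tower n (B : R) (T : ladder R n) k : is_ladder B T ->
  charged T (wt T + k%:R) (tower T k).
Proof.
move=> hT; rewrite towerE; apply: charged_cmul.
by have := charged_mono hT 0 k; rewrite subr0.
Qed.

Definition towerz n (T : ladder R n) (z : int) :=
  match z with Posz k => tower T k | Negz k => tower (ladder_swap T) k.+1 end.

Lemma towerz_swap n (T : ladder R n) z : towerz (ladder_swap T) z = towerz T (- z).
Proof.
case: z => [[|k]|k] /=; rewrite ?oppr0 ?NegzE ?opprK /=.
- by rewrite /tower !mono00.
- by [].
- by rewrite /tower !mono0.
Qed.

Lemma towerz_pos n (T : ladder R n) (k : nat) : towerz T k = tower T k.
Proof. by []. Qed.

Lemma towerz_neg n (T : ladder R n) k : towerz T (Negz k) = tower (ladder_swap T) k.+1.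
Proof. by []. Qed.

Lemma towerz_negS n (T : ladder R n) k : towerz T (Negz k + 1) = tower (ladder_swap T) k.
Proof.
case: k => [|k]; first by rewrite /= /tower !mono00.
by rewrite (_ : Negz k.+1 + 1 = Negz k)//; lia.
Qed.

(** [normalize] sends 0 to 0, so a tower that breaks off is covered as well. *)
Lemma vnorm_towerz_le1 n (T : ladder R n) z : vnorm (towerz T z) <= 1.
Proof. by case: z => k; apply: vnorm_normalize_le1. Qed.

Lemma vnorm_towerz n (T : ladder R n) z : towerz T z != 0 -> vnorm (towerz T z) = 1.
Proof.
have nn k (L : ladder R n) : tower L k != 0 -> vnorm (tower L k) = 1.
  move=> t0; apply: vnorm_normalize; apply: contraNneq t0 => h.
  by rewrite /tower h /normalize scaler0.
by case: z => k; apply: nn.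
Qed.

Opaque towerz tower.

Lemma charged_towerz n (B : R) (T : ladder R n) z : is_ladder B T ->
  charged T (wt T + z%:~R) (towerz T z).
Proof.
move=> hT; case: z => k; first by rewrite towerz_pos; exact: charged_tower hT.
rewrite towerz_neg; have := charged_swap (charged_tower k.+1 (ladder_swapP hT)).
by rewrite NegzE /= opprD opprK mulrNz.
Qed.

(** The 2N rungs of the tower start at -N, ..., N - 1. Those starting at k and at -(k + 1) lie
    between the heights k and k + 1 on the two sides, hence share the index of their errors. *)
Lemma sum_centered (V : zmodType) (f : int -> V) N :
  \sum_(0 <= i < N.*2) f (i%:Z - N%:Z) = \sum_(0 <= k < N) (f k + f (Negz k)).
Proof.
elim: N => [|N IH]; first by rewrite !big_nil.
rewrite doubleS big_nat_recr//= big_nat_recl// [RHS]big_nat_recr//= -IH.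
have e : N.*2.+1%:Z - N.+1%:Z = N by lia.
have e' : 0%:Z - N.+1%:Z = Negz N by lia.
rewrite e e' -addrA addrC -addrA; congr (_ + _).
  by apply: eq_bigr => i _; congr f; lia.
Qed.

Lemma sum_centered_rev (V : zmodType) (f : int -> V) N :
  \sum_(0 <= i < N.*2.+1) f (i%:Z - N%:Z) = \sum_(0 <= i < N.*2.+1) f (- (i%:Z - N%:Z)).
Proof.
rewrite [LHS]big_nat_rev add0n; apply: eq_big_nat => i /andP[_ iN].
by congr f; lia.
Qed.

Definition tower_sum n (T : ladder R n) N := \sum_(0 <= i < N.*2.+1) towerz T (i%:Z - N%:Z).

Lemma tower_sum_swap n (T : ladder R n) N : tower_sum (ladder_swap T) N = tower_sum T N.
Proof.
rewrite /tower_sum [RHS](sum_centered_rev (towerz T)).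
by apply: eq_bigr => i _; rewrite towerz_swap.
Qed.

(* Orthogonality of the errors makes their squares add up: dividing by the number
   of terms leaves a Cesaro mean of the squared errors plus a boundary term. *)
Lemma shift_sum_sqnorm n (A : 'M[R[i]]_n) (g : nat -> 'cV[R[i]]_n) (m : R) N :
  (forall i j, i != j ->
    rinner (A *m g i - cmul m (g i.+1)) (A *m g j - cmul m (g j.+1)) = 0) ->
  vnorm (A *m (\sum_(0 <= i < N.+1) g i) - cmul m (\sum_(0 <= i < N.+1) g i)) ^+ 2 <=
  2 * \sum_(0 <= i < N) vnorm (A *m g i - cmul m (g i.+1)) ^+ 2
  + 2 * vnorm (A *m g N - cmul m (g 0%N)) ^+ 2.
Proof.
move=> orth; pose F i := A *m g i - cmul m (g i.+1).
have pyth : vnorm (\sum_(0 <= i < N) F i) ^+ 2 = \sum_(0 <= i < N) vnorm (F i) ^+ 2.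
  exact: pythagoras (iota_uniq _ _) orth.
have -> : A *m (\sum_(0 <= i < N.+1) g i) - cmul m (\sum_(0 <= i < N.+1) g i) =
    (\sum_(0 <= i < N) F i) + (A *m g N - cmul m (g 0%N)).
  rewrite [in X in _ - X]big_nat_recl//.
  rewrite [in X in X - _]big_nat_recr// mulmxDr cmulDr sumrB mulmx_sumr cmul_sumr.
  by rewrite opprD [- cmul m (g 0%N) - _]addrC addrACA.
by rewrite -[\sum_(0 <= i < N) vnorm (A *m g i - _) ^+ 2]pyth; exact: vnormD_sqr.
Qed.

Section OneTower.
Variables (n : nat) (B m : R) (T : ladder R n) (N : nat) (e : nat -> R).
Hypotheses (hT : is_ladder B T) (m_ge0 : 0 <= m).
Hypothesis up_e : forall k, (k < N)%N -> up_err T m k <= e k.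
Hypothesis dn_e : forall k, (k < N)%N -> dn_err (ladder_swap T) m k <= e k.

Lemma up_tower_sum :
  vnorm (up T *m tower_sum T N - cmul m (tower_sum T N)) ^+ 2 <=
  4 * \sum_(0 <= k < N) e k + 2 * (B + m) ^+ 2.
Proof.
pose g i := towerz T (i%:Z - N%:Z).
(* The i-th error has charge wt + i - N + 1, so different errors are orthogonal. *)
have ch i : charged T (wt T + (i%:Z - N%:Z)%:~R + 1) (up T *m g i - cmul m (g i.+1)).
  apply: chargedD; first by apply: charged_up hT _ _ _; apply: charged_towerz hT.
  rewrite -cmulN1; apply: charged_cmul; apply: charged_cmul.
  have := charged_towerz (i.+1%:Z - N%:Z) hT.
  by rewrite -addrA -[1]/(1%:~R) -intrD; congr (charged T (_ + _%:~R) _); lia.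
have orth i j : i != j ->
    rinner (up T *m g i - cmul m (g i.+1)) (up T *m g j - cmul m (g j.+1)) = 0.
  move=> ij; apply: (charged_orthogonal hT _ (ch i) (ch j)).
  by rewrite (inj_eq (addIr _)) (inj_eq (addrI _)) eqr_int; lia.
have gS i : g i.+1 = towerz T ((i%:Z - N%:Z) + 1) by rewrite /g; congr (towerz T _); lia.
have g1 i : vnorm (g i) <= 1 by exact: vnorm_towerz_le1.
rewrite (le_trans (shift_sum_sqnorm N.*2 orth))// lerD//.
  rewrite (_ : \sum_(_ <= _ < _) _ = \sum_(0 <= k < N) (up_err T m k + dn_err (ladder_swap T) m k)).
    (* One factor 2 comes from [shift_sum_sqnorm], the other from the two rungs of index k. *)
    rewrite -[4]/(2 * 2)%:R natrM -mulrA ler_wpM2l// mulr_sumr.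
    rewrite big_seq [leRHS]big_seq ler_sum// => k; rewrite mem_index_iota => /andP[_ kN].
    by rewrite mulr_natl mulr2n; exact: lerD (up_e kN) (dn_e kN).
  pose f z := vnorm (up T *m towerz T z - cmul m (towerz T (z + 1))) ^+ 2.
  rewrite (eq_bigr (fun i : nat => f (i%:Z - N%:Z))); last first.
    move=> i _; rewrite gS; exact: erefl.
  rewrite (sum_centered f); apply: eq_bigr => k _.
  have -> : f k = up_err T m k by rewrite /f /up_err -PoszD addn1 !towerz_pos.
  by congr (_ + _); rewrite /f /dn_err towerz_negS towerz_neg.
have B0 := ladder_bound_ge0 hT.
rewrite ler_wpM2l// lerXn2r ?nnegrE ?vnorm_ge0//.
  by rewrite addr_ge0.
rewrite (le_trans (vnormB _ _))// lerD//.
  by rewrite (le_trans (lad_up hT _))// -[leRHS]mulr1 ler_wpM2l.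
by rewrite vnormZ ger0_norm// -[leRHS]mulr1 ler_wpM2l.
Qed.

(** Charges match only when z' = z + 1. Then raising the lower state for z >= 0, or lowering the
    upper one by adjointness for z < 0, moves away from the ground state and gives a real multiple
    of the other state, which is orthogonal to its product with 'i. *)
Lemma tower_sum_imag : rinner (tower_sum T N) ('i *: (up T *m tower_sum T N)) = 0.
Proof using hT.
have i0 (v : 'cV[R[i]]_n) : rinner v ('i *: v) = 0.
  by have := rinner_i v v; rewrite [in X in _ = X]rinnerC; lra.
rewrite {1}/tower_sum rinner_suml big1// => i' _.
rewrite /tower_sum mulmx_sumr scaler_sumr rinner_sumr big1// => i _.
set z := (i%:Z - N%:Z); set z' := (_ - _).
have [->|zz'] := eqVneq z' (z + 1); last first.
  apply: (charged_orthogonal hT _ (charged_towerz z' hT)); last first.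
    by apply: chargedZ; apply: charged_up hT _ _ _; exact: charged_towerz hT.
  by rewrite -addrA -[1]/(1%:~R) -intrD (inj_eq (addrI _)) eqr_int.
case: z => k.
  rewrite (_ : Posz k + 1 = Posz k.+1); last by rewrite -PoszD addn1.
  rewrite !towerz_pos !towerE mulmx_cmul -mono0S -cmulZ.
  by rewrite rinnerZl rinnerZr i0 !mulr0.
rewrite towerz_negS towerz_neg !towerE mulmx_cmul -cmulZ.
rewrite rinnerZl rinnerZr rinner_i (lad_adj hT) -scalemxAr.
by rewrite -[dn T]/(up (ladder_swap T)) -mono0S rinnerC i0 oppr0 !mulr0.
Qed.

Lemma tower_sum_sqnormE :
  vnorm (tower_sum T N) ^+ 2 = \sum_(0 <= i < N.*2.+1) vnorm (towerz T (i%:Z - N%:Z)) ^+ 2.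
Proof using hT.
apply: (pythagoras (F := fun i : nat => towerz T (i%:Z - N%:Z))); first exact: iota_uniq.
move=> i j ij; apply: (charged_orthogonal hT _ (charged_towerz _ hT) (charged_towerz _ hT)).
by rewrite (inj_eq (addrI _)) eqr_int; clear -ij; lia.
Qed.

Definition tower_state := cmul (Num.sqrt (N.*2.+1)%:R)^-1 (tower_sum T N).

Let sqrtV_ge0 : 0 <= (Num.sqrt (N.*2.+1)%:R)^-1 :> R.
Proof. by rewrite invr_ge0 sqrtr_ge0. Qed.

Let sqrtV_sqr : (Num.sqrt (N.*2.+1)%:R)^-1 ^+ 2 = (N.*2.+1)%:R^-1 :> R.
Proof. by rewrite exprVn sqr_sqrtr. Qed.

Lemma vnorm_tower_state_le1 : vnorm tower_state <= 1.
Proof using hT.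
rewrite -(@ler_pXn2r _ 2) ?nnegrE ?vnorm_ge0// expr1n vnormZ exprMn ger0_norm//.
rewrite sqrtV_sqr mulrC ler_pdivrMr// mul1r tower_sum_sqnormE.
rewrite -[leRHS]mulr1 mulr_natl -[X in _ *+ X]subn0 -sumr_const_nat ler_sum// => i _.
by rewrite exprn_ile1 ?vnorm_ge0 ?vnorm_towerz_le1.
Qed.

Lemma vnorm_tower_state :
  (forall z : int, `|z|%:Z <= N%:Z -> towerz T z != 0) -> vnorm tower_state = 1.
Proof using hT.
move=> tower_neq0; apply/eqP; rewrite -(@eqrXn2 _ 2)// ?vnorm_ge0// expr1n.
rewrite vnormZ exprMn ger0_norm// sqrtV_sqr tower_sum_sqnormE.
rewrite (eq_big_nat _ _ (F2 := fun=> 1)) ?sumr_const_nat ?subn0 ?mulVf// => i /andP[_ iN].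
by rewrite vnorm_towerz ?expr1n//; apply: tower_neq0; clear -iN; lia.
Qed.

Lemma up_tower_state :
  vnorm (up T *m tower_state - cmul m tower_state) ^+ 2 <=
  (4 * \sum_(0 <= k < N) e k + 2 * (B + m) ^+ 2) / (N.*2.+1)%:R.
Proof.
rewrite /tower_state mulmx_cmul cmulCA -cmulBr vnormZ exprMn ger0_norm// sqrtV_sqr mulrC.
by rewrite ler_wpM2r// up_tower_sum.
Qed.

Lemma tower_state_imag : rinner tower_state ('i *: (up T *m tower_state)) = 0.
Proof using hT.
by rewrite /tower_state mulmx_cmul -cmulZ rinnerZl rinnerZr tower_sum_imag !mulr0.
Qed.

End OneTower.
Lemma tower_state_swap n (T : ladder R n) N : tower_state (ladder_swap T) N = tower_state T N.
Proof. by rewrite /tower_state tower_sum_swap. Qed.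

Lemma tower_error_cvg0 (e : nat -> R) (c : R) : e k @[k --> \oo] --> 0 ->
  ((4 * \sum_(0 <= k < N) e k + c) / (N.*2.+1)%:R) @[N --> \oo] --> 0.
Proof.
move=> e0; pose u N := (4 * \sum_(0 <= k < N) e k + c) / (N.*2.+1)%:R.
rewrite -(cvg_shiftS u).
have h1 := seq_cvgMl (c := 4) (seq_cvg_norm0 (cesaro e0)).
have := seq_cvgD h1 (seq_cvgMl (c := `|c|) (@cvg_harmonic R)); rewrite !mulr0 addr0 => h2.
apply: (cvg0_le _ h2) => N; rewrite /u /arithmetic_mean /series /harmonic /=.
have le1 : (N.+1.*2.+1)%:R^-1 <= N.+1%:R^-1 :> R by rewrite lef_pV2 ?posrE// ler_nat; lia.
rewrite mulrDl (le_trans (ler_normD _ _))// !normrM lerD//; last first.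
  by rewrite ler_wpM2l// ger0_norm.
rewrite [`|4|]ger0_norm// -mulrA ler_wpM2l// mulrC ler_wpM2r//.
by rewrite !ger0_norm.
Qed.

End TowerSuperposition.

(** * The ladder of the lattice system *)

Section SystemLadder.
Variables (R : realType) (d D : nat) (S : lattice_system R d D).
Variables (a h0 o0 : R) (zeta L : nat).
Hypotheses (L_size : lattice_size L) (HA1 : conserved_operator S a L).
Hypotheses (HA2 : order_operators S L) (HA3 : local_operators S zeta h0 o0 L).
Hypothesis (HA4 : symmetric_ground_state S L).

Definition system_ladder : ladder R #|config d D L| :=
  Ladder (density (raising S L)) (density (lowering S L)) (cop S L) (gs S L)
    (expval (cop S L) (gs S L)) (2 / (volume d L)%:R ^+ 2).

Lemma volume_gt0 : (0 < volume d L)%N.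
Proof. by rewrite expn_gt0; case/andP: L_size => ->. Qed.

Lemma card_site : #|{: site d L}| = volume d L.
Proof.
rewrite card_mx mul1n card_ord Zp_cast//.
by case: L L_size => [|[|n]].
Qed.

Lemma density_mul (A : oper R d D L) v : density A *m v = cmul (volume d L)%:R^-1 (A *m v).
Proof. by rewrite /density -scalemxAl scale_natV. Qed.

Lemma order_op_adj al u v : rinner u (order_op S al L *m v) = rinner (order_op S al L *m u) v.
Proof.
case: HA2 => sa _ _ _ _; rewrite !mulmx_suml rinner_sumr rinner_suml.
by apply: eq_bigr => x _; apply: selfadjoint_rinner.
Qed.

Lemma raising_adj u v : rinner u (raising S L *m v) = rinner (lowering S L *m u) v.
Proof.
rewrite mulmxDl mulmxBl rinnerDr rinnerDl rinnerNl -!scalemxAl rinner_i.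
by rewrite !order_op_adj scalemxAr.
Qed.

(** The triangle inequality costs one factor per site, and the density divides by their number: the
    bound is the same at all sizes. *)
Lemma vnorm_sum_oper (A : site d L -> oper R d D L) :
  (forall x, opnorm (A x) = o0) ->
  forall v, vnorm (density (\sum_x A x) *m v) <= o0 * vnorm v.
Proof.
move=> Ao v; rewrite density_mul vnormZ ger0_norm ?invr_ge0// mulmx_suml.
rewrite mulrC ler_pdivrMr ?ltr0n ?volume_gt0//.
rewrite (le_trans (vnorm_sum _ _ _))// (le_trans (ler_sum _ (fun x _ => vnorm_opnorm (A x) v)))//.
under eq_bigr do rewrite Ao.
by rewrite sumr_const card_site mulr_natr.
Qed.

Lemma raising_sum : raising S L = \sum_x (oloc S comp1 x + 'i *: oloc S comp2 x).
Proof. by rewrite big_split /= -scaler_sumr. Qed.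

Lemma lowering_sum : lowering S L = \sum_x (oloc S comp1 x - 'i *: oloc S comp2 x).
Proof. by rewrite sumrB -scaler_sumr. Qed.

Lemma lowering_scale : lowering S L = order_op S comp1 L + (- 'i) *: order_op S comp2 L.
Proof. by rewrite scaleNr. Qed.

Lemma commutator_raising : commutator (raising S L) (cop S L) = - raising S L.
Proof.
case: HA2 => _ _ c1 c2 _; rewrite /raising commutatorDl commutatorZl c1 c2.
by rewrite scalerA -expr2 sqrCi scaleN1r scaleNr opprD addrC.
Qed.

Lemma commutator_lowering : commutator (lowering S L) (cop S L) = lowering S L.
Proof.
case: HA2 => _ _ c1 c2 _; rewrite lowering_scale commutatorDl commutatorZl c1 c2.
by rewrite scalerA mulNr -expr2 sqrCi opprK scale1r addrC.
Qed.

Lemma commutator_raising_lowering :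
  commutator (raising S L) (lowering S L) = 2 *: cop S L.
Proof.
case: HA2 => _ _ _ _ c; rewrite lowering_scale /raising.
rewrite !(commutatorDl, commutatorDr, commutatorZl, commutatorZr) !commutatorXX !scaler0.
rewrite addr0 add0r (commutatorNC (order_op S comp2 L)) c scalerN !scalerA -scaleNr -scalerDl.
by congr (_ *: _); rewrite mulNr -expr2 sqrCi opprK -mulr2n.
Qed.

(** The eigenvalue is given as a complex number; pairing with the unit vector [gs S L] identifies it
    with an expectation, real by self-adjointness. *)
Lemma system_eigenvalue :
  cop S L *m gs S L = cmul (expval (cop S L) (gs S L)) (gs S L).
Proof.
case: HA4 => -[[n1 _] _] [m Cm].
case: HA1 => sa _ _ _; have := expval_selfadjoint (gs S L) sa.
rewrite Cm /inner -scalemxAr mxE -/(inner _ _).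
rewrite inner_sqr n1 expr1n rmorph1 mulr1 => ->.
exact: erefl.
Qed.

Lemma expval_cop_bound : `|expval (cop S L) (gs S L)| <= a * (volume d L)%:R.
Proof.
case: HA4 => -[[n1 _] _] _; case: HA1 => _ _ lb ub.
have e (x : R) : rinner (gs S L) ((x%:C)%C%:M *m gs S L) = x.
  by rewrite mul_cscalar_mx rinnerZr -vnorm_sqr n1 expr1n mulr1.
have eN (x : R) : rinner (gs S L) ((- (x%:C)%C)%:M *m gs S L) = - x.
  by rewrite -[- (x%:C)%C](rmorphN (real_complex R)) e.
have pos (A : oper R d D L) v : 0 <= inner v (A *m v) -> 0 <= rinner v (A *m v).
  by rewrite lecE => /andP[].
have := pos _ _ (lb (gs S L)); have := pos _ _ (ub (gs S L)).
rewrite !mulmxBl !rinnerDr !rinnerNr eN e -expvalE opprK.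
by rewrite ler_norml => h1 h2; apply/andP; split; lra.
Qed.

Lemma system_is_ladder : is_ladder o0 system_ladder.
Proof.
have n1 : vnorm (gs S L) = 1 by case: HA4 => -[[]].
have s1 : o0 * 1 = o0 by rewrite mulr1.
case: HA3 => _ _ _ op om; split; rewrite /system_ladder; cbn [up dn chg vac wt kap] => //.
- by move=> u v; rewrite !density_mul rinnerZr rinnerZl raising_adj.
- by rewrite raising_sum; apply: vnorm_sum_oper.
- by rewrite lowering_sum; apply: vnorm_sum_oper.
- by case: HA1 => sa _ _ _; apply: selfadjoint_rinner.
- move=> v; rewrite !density_mul mulmx_cmul -cmulDr; congr cmul.
  rewrite !mulmxA -mulmxDl; congr (_ *m _).
  have := commutator_raising; rewrite /commutator => /eqP.
  by rewrite subr_eq addrC -subr_eq opprK => /eqP.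
- move=> v; rewrite !density_mul mulmx_cmul -cmulBr; congr cmul.
  rewrite !mulmxA -mulmxBl; congr (_ *m _).
  by have := commutator_lowering; rewrite /commutator => {3}<-; rewrite opprB addrC subrK.
- move=> v; rewrite !density_mul !mulmx_cmul -cmulBr -cmulBr cmulA !mulmxA -mulmxBl.
  rewrite -[_ *m _ - _]/(commutator _ _) commutator_raising_lowering.
  rewrite -scalemxAl scale_nat.
  by rewrite cmulA -expr2 exprVn mulrC.
- exact: system_eigenvalue.
Qed.

End SystemLadder.

(** [comp_sign] and [comp_phase] encode O^(1) = (O^+ + O^-)/2 and O^(2) = -i (O^+ - O^-)/2. *)
Definition comp_sign (R : realType) (al : component) : R :=
  match al with comp1 => 1 | comp2 => -1 end.

Definition comp_phase (R : realType) (al : component) : R[i] :=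
  match al with comp1 => 1 | comp2 => - 'i end.

(** * Order operators and tower states in terms of the ladder *)

Section SystemObservables.
Variables (R : realType) (d D : nat) (S : lattice_system R d D) (L : nat).
Let T := system_ladder S L.

Lemma comp_sign_sqr al : comp_sign R al ^+ 2 = 1.
Proof. by case: al; rewrite /= ?sqrrN expr1n. Qed.

Lemma vnorm_phase al k (v : state R d D L) : vnorm (comp_phase R al ^+ k *: v) = vnorm v.
Proof.
elim: k => [|k IH]; first by rewrite expr0 scale1r.
rewrite exprS -scalerA -IH; case: al {IH} => /=; first by rewrite scale1r.
by rewrite scaleNr vnormN vnormi.
Qed.

Lemma mulmxX n (A : 'M[R[i]]_n) k (v : 'cV[R[i]]_n) : A ^+ k *m v = iter k (mulmx A) v.
Proof.
elim: k => [|k IH]; first by rewrite expr0 mul1mx.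
by rewrite exprS -mulmxA IH.
Qed.

Lemma density_order_op al v : density (order_op S al L) *m v =
  comp_phase R al *: cmul 2^-1 (up T *m v + cmul (comp_sign R al) (dn T *m v)).
Proof.
rewrite [up T]/(density (raising S L)) [dn T]/(density (lowering S L)) !density_mul.
rewrite cmulCA -cmulDr cmulCA -cmulZ; congr cmul; rewrite mulmxDl mulmxBl -!scalemxAl.
set x := order_op S comp1 L *m v; set y := 'i *: (order_op S comp2 L *m v).
have half (w : state R d D L) : cmul 2^-1 (w + w) = w.
  by rewrite cmulDr -cmulDl (_ : 2^-1 + 2^-1 = 1 :> R) ?cmul1//; lra.
case: al => /=; first by rewrite scale1r cmul1 addrACA subrr addr0 half.
rewrite cmulN1 opprB addrC addrA subrK half scalerA mulNr -expr2 sqrCi opprK.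
by rewrite scale1r.
Qed.

Lemma density_order_opX al k : vnorm (density (order_op S al L) ^+ k *m gs S L) ^+ 2 =
  vnorm (quad_iter T (comp_sign R al) k) ^+ 2 / 4 ^+ k.
Proof.
have -> : density (order_op S al L) ^+ k *m gs S L =
    comp_phase R al ^+ k *: cmul (2^-1 ^+ k) (quad_iter T (comp_sign R al) k).
  rewrite mulmxX; elim: k => [|k IH]; first by rewrite !expr0 scale1r cmul1.
  rewrite [LHS]iterS IH density_order_op -!(scalemxAr (comp_phase R al ^+ k)) !mulmx_cmul.
  rewrite [cmul (comp_sign R al) _]cmulZ cmulCA -scalerDr -cmulDr.
  by rewrite cmulZ cmulA scalerA -!exprS.
rewrite vnorm_phase vnormZ exprMn mulrC; congr (_ * _).
by rewrite normrX ger0_norm// -exprVn exprAC; congr (_ ^+ _); rewrite expr2 -invfM -natrM.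
Qed.

Hypothesis HA2 : order_operators S L.

Lemma density_order_op_adj al u v :
  rinner u (density (order_op S al L) *m v) = rinner (density (order_op S al L) *m u) v.
Proof. by rewrite !density_mul rinnerZr rinnerZl order_op_adj. Qed.

Lemma expval_even al k v :
  expval (density (order_op S al L) ^+ k.*2) v =
  vnorm (density (order_op S al L) ^+ k *m v) ^+ 2.
Proof.
rewrite expvalE vnorm_sqr -addnn exprD -mulmxA !mulmxX.
set A := mulmx (density (order_op S al L)).
suff adjX u w : rinner u (iter k A w) = rinner (iter k A u) w by exact: adjX.
elim: k u => [|k IH] u //.
by rewrite iterS /A density_order_op_adj -/A IH -iterSr.
Qed.

Lemma expval_sqr al v :
  expval (density (order_op S al L) ^+ 2) v = vnorm (density (order_op S al L) *m v) ^+ 2.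
Proof. exact: (expval_even al 1). Qed.

Lemma order_moment_even al k : (0 < k)%N ->
  order_moment S al k L ^+ k.*2 = vnorm (quad_iter T (comp_sign R al) k) ^+ 2 / 4 ^+ k.
Proof.
move=> k0; rewrite /order_moment expval_even density_order_opX.
have h : 0 <= vnorm (quad_iter T (comp_sign R al) k) ^+ 2 / 4 ^+ k.
  by rewrite divr_ge0 ?sqr_ge0.
rewrite -powR_mulrn ?powR_ge0// -powRrM mulVf ?powRr1//.
by rewrite pnatr_eq0 double_eq0 -lt0n.
Qed.

Hypothesis gs1 : vnorm (gs S L) = 1.
Hypothesis L_size : lattice_size L.

Lemma normalize_cmul n c (v : 'cV[R[i]]_n) : 0 < c -> normalize (cmul c v) = normalize v.
Proof.
move=> c0; rewrite !normalizeE vnormZ cmulA ger0_norm ?ltW//.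
by rewrite invfM mulrAC mulVf ?gt_eqF// mul1r.
Qed.

Let V_gt0 : 0 < (volume d L)%:R^-1 :> R.
Proof. by rewrite invr_gt0 ltr0n volume_gt0. Qed.

Let iter_density A k :
  iter k (mulmx (density A)) (gs S L) = cmul ((volume d L)%:R^-1 ^+ k) (A ^+ k *m gs S L).
Proof.
rewrite mulmxX; elim: k => [|k IH]; first by rewrite cmul1.
by rewrite !iterS IH density_mul mulmx_cmul cmulA -exprS.
Qed.

(** Normalization absorbs the positive power of 1/V that separates O^+ and O^- from their
    densities. *)
Lemma GammaE z : Gamma S L z = towerz T z.
Proof.
rewrite /Gamma; case: z => [[|k]|k].
- rewrite eqxx towerz_pos towerE mono00 [vac T]/(gs S L).
  by rewrite /sqmom mono00 [vac T]/(gs S L) gs1 expr1n sqrtr1 invr1 cmul1.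
- rewrite towerz_pos tower_normalize mono0 [up T]/(density _) [vac T]/(gs S L) iter_density.
  by rewrite normalize_cmul ?exprn_gt0.
- rewrite towerz_neg tower_normalize mono0 [up _]/(density (lowering S L)) [vac _]/(gs S L).
  by rewrite iter_density normalize_cmul ?exprn_gt0.
Qed.

Lemma XiE N : Xi S L N = tower_state T N.
Proof.
rewrite /tower_state /tower_sum big_mkord.
under [in RHS]eq_bigr do rewrite -GammaE.
exact: erefl.
Qed.

End SystemObservables.

(** * The limit of the superpositions *)

(** A diagonal choice: [g L] is the largest n <= L such that P holds at L for all k < n, raised to 1
    if this is 0. The value 1 thus carries no information, hence the premise [1 < g L]; the cap L
    grows along [sz] because j <= sz j. *)
Lemma slow_cutoff (P : nat -> nat -> bool) (sz : nat -> nat) :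
  (forall j, (j <= sz j)%N) -> (forall k, \forall j \near \oo, P k (sz j)) ->
  exists g : nat -> nat, [/\ forall L, (0 < g L)%N, g (sz j) @[j --> \oo] --> \oo &
    forall L k, (1 < g L)%N -> (k < g L)%N -> P k L].
Proof.
move=> szj Psz; pose Q L n := all (P^~ L) (iota 0 n).
pose g L := maxn 1 (\max_(n < L.+1 | Q L n) n).
have Qg L : Q L (\max_(n < L.+1 | Q L n) n).
  by apply: (big_ind (Q L)) => // x y qx qy; rewrite /maxn; case: ifP.
exists g; split=> [L||L k].
- by rewrite leq_max.
- apply/cvgnyPge => A.
  have QA : \forall j \near \oo, Q (sz j) A.
    elim: A => [|A IH]; first exact: nearW.
    near=> j; rewrite /Q -addn1 iotaD all_cat /= andbT; apply/andP; split.
      by near: j.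
    by rewrite add0n; near: j; exact: Psz.
  near=> j; have QjA : Q (sz j) A by near: j.
  have Asz : (A < (sz j).+1)%N.
    rewrite ltnS; apply: leq_trans (szj j); near: j; exact: nbhs_infty_ge.
  rewrite /g leq_max; apply/orP; right.
  exact: (leq_bigmax_cond (Ordinal Asz)).
- rewrite {1}/g leq_max ltnn /= => g1; rewrite /g (maxn_idPr (ltnW g1)) => kg.
  by have /allP := Qg L; apply; rewrite mem_iota.
Unshelve. all: by end_near. Qed.

Section StateLimits.
Variables (R : realType) (dim : nat -> nat) (B m : R) (N : nat -> nat) (e : nat -> R).
Hypotheses (m_ge0 : 0 <= m) (e0 : e k @[k --> \oo] --> 0) (N_oo : N j @[j --> \oo] --> \oo).

Lemma tower_state_close (T : forall j, ladder R (dim j)) :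
  (forall j, is_ladder B (T j)) ->
  (\forall j \near \oo, forall k, (k < N j)%N ->
     up_err (T j) m k <= e k /\ dn_err (ladder_swap (T j)) m k <= e k) ->
  vclose (fun j => up (T j) *m tower_state (T j) (N j))
         (fun j => cmul m (tower_state (T j) (N j))).
Proof.
move=> hT err.
have b0 := cvg_comp _ _ N_oo (tower_error_cvg0 (2 * (B + m) ^+ 2) e0).
pose X j := tower_state (T j) (N j).
have sq0 : vnorm (up (T j) *m X j - cmul m (X j)) ^+ 2 @[j --> \oo] --> 0.
  apply: (squeeze_cvgr _ (cvg_cst 0) b0); near=> j; rewrite sqr_ge0 /=.
  have err' : forall k, (k < N j)%N ->
     up_err (T j) m k <= e k /\ dn_err (ladder_swap (T j)) m k <= e k by near: j.
  by apply: (up_tower_state (hT j) m_ge0) => k /err'[].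
have := seq_cvg_sqrt sq0; rewrite sqrtr0 /vclose.
by under eq_fun do rewrite sqrtr_sqr ger0_norm ?vnorm_ge0//.
Unshelve. all: by end_near. Qed.

End StateLimits.

(** * Expectation values in approximate eigenvectors *)

Section ObservableLimits.
Variables (R : realType) (d D : nat) (S : lattice_system R d D) (m : R).
Variables (sz : nat -> nat) (X : forall j, state R d D (sz j)).
Hypothesis X_le1 : forall j, vnorm (X j) <= 1.
Hypothesis X_1 : \forall j \near \oo, vnorm (X j) = 1.
Hypothesis HA2 : forall j, order_operators S (sz j).
Let T j := system_ladder S (sz j).
Hypothesis up_close : vclose (fun j => up (T j) *m X j) (fun j => cmul m (X j)).
Hypothesis dn_close : vclose (fun j => dn (T j) *m X j) (fun j => cmul m (X j)).

Lemma order1_close :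
  vclose (fun j => density (order_op S comp1 (sz j)) *m X j) (fun j => cmul m (X j)).
Proof.
apply: (@vclose_trans _ _ (fun j => cmul 2^-1 (up (T j) *m X j + dn (T j) *m X j))).
  by apply: vclose_eq => j; rewrite density_order_op /= scale1r cmul1.
apply: vclose_trans (vclose_cmul 2^-1 (vcloseD up_close dn_close)) _.
apply: vclose_eq => j; rewrite -cmulDl cmulA; congr cmul.
lra.
Qed.

Lemma order1_expval_cvg :
  expval (density (order_op S comp1 (sz j))) (X j) @[j --> \oo] --> m.
Proof.
apply: cvg_sub_cvg (vclose_rinner X_le1 order1_close) _.
apply: cvg_near_cst; near=> j; rewrite rinnerZr -vnorm_sqr.
have -> : vnorm (X j) = 1 by near: j.
by rewrite expr1n mulr1.
Unshelve. all: by end_near. Qed.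

Lemma order1_sqr_cvg :
  expval (density (order_op S comp1 (sz j)) ^+ 2) (X j) @[j --> \oo] --> m ^+ 2.
Proof.
under eq_fun do rewrite (expval_sqr (HA2 _)).
have mX j : vnorm (cmul m (X j)) <= `|m| by rewrite vnormZ -[leRHS]mulr1 ler_wpM2l.
apply: cvg_sub_cvg (vclose_sqnorm mX order1_close) _.
apply: cvg_near_cst; near=> j; rewrite vnormZ.
have -> : vnorm (X j) = 1 by near: j.
by rewrite mulr1 real_normK ?num_real.
Unshelve. all: by end_near. Qed.

Lemma order2_sqr_cvg :
  expval (density (order_op S comp2 (sz j)) ^+ 2) (X j) @[j --> \oo] --> (0 : R).
Proof.
under eq_fun do rewrite (expval_sqr (HA2 _)).
have h : vclose (fun j => cmul 2^-1 (up (T j) *m X j + cmul (-1) (dn (T j) *m X j))) (fun=> 0).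
  apply: vclose_trans (vclose_cmul 2^-1 (vcloseD up_close (vclose_cmul (-1) dn_close))) _.
  by apply: vclose_eq => j; rewrite cmulN1 subrr -[X in cmul _ X](cmul0 0) cmulCA cmul0.
have z j : vnorm ((fun=> 0) j : state R d D (sz j)) <= 0 by rewrite vnorm0.
have := vclose_sqnorm z h.
under eq_fun do
  rewrite vnorm0 expr0n subr0 -(vnorm_phase comp2 1) expr1 -[- 1]/(comp_sign R comp2) -density_order_op.
by [].
Qed.

End ObservableLimits.

(** The raising part vanishes by [tower_state_imag], the lowering part by the same lemma for the
    swapped ladder, whose tower state is the same vector. *)
Lemma order2_expval0 (R : realType) (d D : nat) (S : lattice_system R d D) L (B : R) N :
  is_ladder B (system_ladder S L) ->
  expval (density (order_op S comp2 L)) (tower_state (system_ladder S L) N) = 0.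
Proof.
move=> hT; rewrite expvalE density_order_op /= -cmulZ rinnerZr.
rewrite scaleNr scalerDr rinnerNr rinnerDr (tower_state_imag N hT).
rewrite cmulN1 scalerN rinnerNr.
have := tower_state_imag N (ladder_swapP hT); rewrite tower_state_swap.
by rewrite -[up _]/(dn _) => ->; rewrite oppr0 addr0 oppr0 mulr0.
Qed.

(** * The thermodynamic limit *)

Opaque up_err dn_err.

Section ThermodynamicLimit.
Variables (R : realType) (d D : nat) (S : lattice_system R d D).
Variables (a h0 o0 q0 C1 : R) (zeta : nat) (alpha : component) (sz : nat -> nat).
Hypothesis d_gt0 : (0 < d)%N.
Hypothesis HA1 : forall L, lattice_size L -> conserved_operator S a L.
Hypothesis HA2 : forall L, lattice_size L -> order_operators S L.
Hypothesis HA3 : forall L, lattice_size L -> local_operators S zeta h0 o0 L.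
Hypothesis HA4 : forall L, lattice_size L -> symmetric_ground_state S L.
Hypothesis q0_gt0 : 0 < q0.
Hypothesis HA5 : forall L, lattice_size L -> long_range_order S q0 L.
Hypothesis C1_gt0 : 0 < C1.
Hypothesis Htower : forall L, lattice_size L -> tower_well_defined S C1 L.
Hypothesis sz_size : forall j, lattice_size (sz j).
Hypothesis sz_incr : forall j, (sz j < sz j.+1)%N.
Hypothesis Hlim : forall k, (0 < k)%N -> cvgn (fun j : nat => order_moment S alpha k (sz j)).

Let T L := system_ladder S L.

Lemma sz_gt j : (j < sz j)%N.
Proof.
elim: j => [|j IH]; first by case/andP: (sz_size 0%N).
exact: leq_ltn_trans IH (sz_incr j).
Qed.

Lemma volume_sz_gt j : (j < volume d (sz j))%N.
Proof.
apply: leq_trans (sz_gt j) _; rewrite -{1}[sz j]expn1 leq_pexp2l//.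
exact: leq_ltn_trans (sz_gt j).
Qed.

Lemma gs_norm L : lattice_size L -> vnorm (gs S L) = 1.
Proof. by move=> /HA4[[[]]]. Qed.

Lemma T_ladder L : lattice_size L -> is_ladder o0 (T L).
Proof. by move=> hL; apply: system_is_ladder (HA1 hL) (HA2 hL) (HA3 hL) (HA4 hL). Qed.

Lemma volumeV_cvg0 : (volume d (sz j))%:R^-1 @[j --> \oo] --> (0 : R).
Proof.
apply: (cvg0_le _ (@cvg_harmonic R)) => j; rewrite ger0_norm// /harmonic /=.
by rewrite lef_pV2 ?posrE ?ltr0n ?ler_nat//; apply: leq_ltn_trans (volume_sz_gt j).
Qed.

Lemma kap_cvg0 : kap (T (sz j)) @[j --> \oo] --> 0.
Proof.
have := seq_cvgMl (c := 2) (seq_cvgX (k := 2) volumeV_cvg0).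
by rewrite expr0n mulr0; under eq_fun do rewrite exprVn.
Qed.

Lemma kapwt_cvg0 : (kap (T (sz j)) * wt (T (sz j))) @[j --> \oo] --> 0.
Proof.
(* 2 / V^2 times the bound a V on the charge is 2 a / V. *)
have := seq_cvgMl (c := 2 * a) volumeV_cvg0; rewrite mulr0 => h.
apply: (cvg0_le _ h) => j /=; rewrite normrM ger0_norm ?divr_ge0 ?exprn_ge0//.
have V0 : 0 < (volume d (sz j))%:R :> R by rewrite ltr0n (leq_ltn_trans _ (volume_sz_gt j)).
apply: le_trans (ler_wpM2l _ (expval_cop_bound (HA1 (sz_size j)) (HA4 (sz_size j)))) _.
  by rewrite divr_ge0 ?exprn_ge0.
rewrite le_eqVlt; apply/orP; left; apply/eqP.
by field; rewrite gt_eqF.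
Qed.

Let hT j : is_ladder o0 (T (sz j)) := T_ladder (sz_size j).

Lemma moment_sqmom al k :
  (vnorm (quad_iter (T (sz j)) (comp_sign R al) k) ^+ 2 / 4 ^+ k
    - arcsine_moment R k * sqmom (T (sz j)) k) @[j --> \oo] --> 0.
Proof.
have := seq_cvgMl (c := (4 ^+ k)^-1)
  (quad_moment_sqmom hT kap_cvg0 kapwt_cvg0 k (comp_sign_sqr R al)).
rewrite mulr0; under eq_fun do rewrite mulrBr mulrC mulrA [(4 ^+ k)^-1 * _]mulrC.
by [].
Qed.

Lemma sqmom_cvg k : exists l : R, sqmom (T (sz j)) k @[j --> \oo] --> l.
Proof.
have [->|k0] := posnP k.
  by exists 1; under eq_fun do rewrite (sqmom0 (hT _)); exact: cvg_cst.
have a0 := lt0r_neq0 (arcsine_moment_gt0 R k).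
exists ((arcsine_moment R k)^-1 * limn (fun j => order_moment S alpha k (sz j)) ^+ k.*2).
have := seq_cvgX (k := k.*2) (Hlim k0).
under eq_fun do rewrite (order_moment_even (HA2 (sz_size _)))//.
move=> /(cvg_sub_cvg (cvg_sub_sym (moment_sqmom alpha k)))
  /(seq_cvgMl (c := (arcsine_moment R k)^-1)).
by under eq_fun do rewrite mulrA mulVf// mul1r.
Qed.

Section Limits.
Variable s : nat -> R.
Hypothesis hs : forall k, sqmom (T (sz j)) k @[j --> \oo] --> s k.

(** The second moment of O^(1)/V is at least [q0] at every size and tends to
    [arcsine_moment R 1 * s 1]. *)
Lemma lim_sqmom1_gt0 : 0 < s 1%N.
Proof.
have a_gt0 := arcsine_moment_gt0 R 1.
rewrite -(pmulr_rgt0 _ a_gt0); apply: lt_le_trans q0_gt0 _.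
have cv := cvg_sub_cvg (moment_sqmom comp1 1) (seq_cvgMl (c := arcsine_moment R 1) (hs (k := 1%N))).
refine (ler_cvg_to (cvg_cst q0) cv _); apply: nearW => j.
have [_] := HA5 (sz_size j).
by rewrite (expval_even (HA2 (sz_size j)) comp1 1) density_order_opX.
Qed.

Let s0 := lim_sqmom0 hT hs.
Let s_convex := lim_sqmom_convex hT kap_cvg0 kapwt_cvg0 hs.

(* For k = 0 both sides are x `^ 0 = 1, because 0^-1 = 0. *)
Lemma order_moment_lim k :
  limn (fun j => order_moment S alpha k (sz j)) = (arcsine_moment R k * s k) `^ (k.*2%:R)^-1.
Proof.
have [->|k0] := posnP k.
  rewrite /order_moment /= invr0 powRr0; under eq_fun do rewrite powRr0.
  exact: lim_cst.
set y := limn _; have hy : order_moment S alpha k (sz j) @[j --> \oo] --> y by exact: Hlim.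
have y_ge0 : 0 <= y.
  by apply: limr_ge; [exact: Hlim|apply: nearW => j; exact: powR_ge0].
have : y ^+ k.*2 = arcsine_moment R k * s k.
  apply: (seq_cvg_uniq (seq_cvgX (k := k.*2) hy)).
  under eq_fun do rewrite (order_moment_even (HA2 (sz_size _)))//.
  exact: cvg_sub_cvg (moment_sqmom alpha k) (seq_cvgMl (hs (k := k))).
move=> <-; rewrite -powR_mulrn// -powRrM mulfV ?powRr1//.
by rewrite pnatr_eq0 double_eq0 -lt0n.
Qed.

Lemma order_parameterE (m : R) : 0 < m -> (s k.+1 / s k) @[k --> \oo] --> m ^+ 2 ->
  order_parameter S alpha sz = m.
Proof.
move=> m_gt0 sm; rewrite /order_parameter; under eq_fun do rewrite order_moment_lim.
have := logconvex_root s0 lim_sqmom1_gt0 s_convex (exprn_gt0 2 m_gt0) sm.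
rewrite sqrtr_sqr gtr0_norm// => h.
by apply: (cvg_lim _ h); exact: norm_hausdorff.
Qed.

End Limits.

Let kapS : kap (ladder_swap (T (sz j))) @[j --> \oo] --> 0.
Proof. exact: kap_cvg0. Qed.

Let kapwtS : (kap (ladder_swap (T (sz j))) * wt (ladder_swap (T (sz j)))) @[j --> \oo] --> 0.
Proof.
have := seq_cvgMl (c := -1) kapwt_cvg0; rewrite mulr0.
by under eq_fun do rewrite mulN1r -mulrN.
Qed.

(** The words of the swapped ladder are the [mono T k 0], and the limits in [lim_mono] depend only
    on the total number of factors. *)
Lemma sqmom_swap_cvg (s : nat -> R) :
  (forall k, sqmom (T (sz j)) k @[j --> \oo] --> s k) ->
  forall k, sqmom (ladder_swap (T (sz j))) k @[j --> \oo] --> s k.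
Proof.
move=> hs k; have := lim_mono hT kap_cvg0 kapwt_cvg0 hs (k := k) (l := 0).
rewrite addn0; under eq_fun do
  rewrite mono_swap -[dn _]/(up (ladder_swap _)) -[vac _]/(vac (ladder_swap _)) -mono0.
by [].
Qed.

Lemma tower_boundE L z : lattice_size L -> `|z|%:~R <= tower_bound d C1 L ->
  towerz (T L) z != 0.
Proof.
move=> hL /(Htower hL) tz; rewrite -(GammaE (gs_norm hL) hL) /Gamma.
have n0 (v : state R d D L) : vnorm v = 1 -> v != 0.
  by move=> v1; apply/eqP => v0; move: v1; rewrite v0 vnorm0 => /esym/eqP; rewrite oner_eq0.
by case: ifP => _; apply: n0; [exact: gs_norm|exact: vnorm_normalize].
Qed.

Lemma tower_bound_near k : \forall j \near \oo, k.+1%:R <= tower_bound d C1 (sz j).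
Proof.
near=> j; rewrite /tower_bound -ler_pdivrMl//.
rewrite -[leLHS]ger0_norm ?mulr_ge0 ?invr_ge0 ?(ltW C1_gt0)// -sqrtr_sqr ler_wsqrtr//.
apply: (@le_trans _ _ j%:R); last by rewrite ler_nat ltnW// volume_sz_gt.
by near: j; exact: nbhs_infty_ger.
Unshelve. all: by end_near. Qed.

(** Raising and lowering the full tower involve both errors of both ladders; the last clause serves
    to make the cutoff admissible. *)
Definition tower_control (m : R) (e : nat -> R) k L :=
  [&& up_err (T L) m k <= e k, dn_err (ladder_swap (T L)) m k <= e k,
      up_err (ladder_swap (T L)) m k <= e k, dn_err (T L) m k <= e k &
      k.+1%:R <= tower_bound d C1 L].

Lemma tower_control_exists : exists (m : R) (e : nat -> R),
  [/\ 0 <= m, order_parameter S alpha sz = m, e k @[k --> \oo] --> 0 &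
      forall k, \forall j \near \oo, tower_control m e k (sz j)].
Proof.
have [s hs] := boolp.choice sqmom_cvg.
have s1 := lim_sqmom1_gt0 hs.
have hsS := sqmom_swap_cvg hs.
have hTS j := ladder_swapP (hT j).
have [l l_gt0 sl] := logconvex_ratio_cvg (lim_sqmom0 hT hs) s1
  (lim_sqmom_convex hT kap_cvg0 kapwt_cvg0 hs) (lim_sqmomS_le hT hs).
pose m := Num.sqrt l; have m_gt0 : 0 < m by rewrite sqrtr_gt0.
have sm : (s k.+1 / s k) @[k --> \oo] --> m ^+ 2 by rewrite sqr_sqrtr ?ltW.
(* The harmonic term makes [e k] strictly larger than the limits, so that the errors are eventually
   below it. *)
pose e k := `|up_err_lim s m k| + `|dn_err_lim s m k| + harmonic k.
have e_near (f : nat -> R) k (x : R) : x <= `|up_err_lim s m k| + `|dn_err_lim s m k| ->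
    f j @[j --> \oo] --> x -> \forall j \near \oo, f j <= e k.
  move=> xe fx; apply: (@cvgr_le _ _ _ _ f x fx); rewrite (le_lt_trans xe)// /e ltrDl.
  by rewrite /harmonic /= invr_gt0 ltr0n.
have ue k : up_err_lim s m k <= `|up_err_lim s m k| + `|dn_err_lim s m k|.
  by rewrite (le_trans (ler_norm _))// lerDl.
have de k : dn_err_lim s m k <= `|up_err_lim s m k| + `|dn_err_lim s m k|.
  by rewrite (le_trans (ler_norm _))// lerDr.
exists m, e; split.
- exact: ltW.
- refine (order_parameterE hs m_gt0 sm).
- have u0 := up_err_lim_cvg0 hT kap_cvg0 kapwt_cvg0 hs s1 (ltW m_gt0) sm.
  have d0 := dn_err_lim_cvg0 hT kap_cvg0 kapwt_cvg0 hs s1 (ltW m_gt0) sm.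
  have h := seq_cvgD (seq_cvgD (seq_cvg_norm0 u0) (seq_cvg_norm0 d0)) (@cvg_harmonic R).
  rewrite !addr0 in h; exact h.
move=> k.
have n1 := e_near _ _ _ (ue k) (up_err_cvg hT kap_cvg0 kapwt_cvg0 hs s1 (m := m) (k := k)).
have n2 := e_near _ _ _ (de k) (dn_err_cvg hTS kapS kapwtS hsS s1 (m := m) (k := k)).
have n3 := e_near _ _ _ (ue k) (up_err_cvg hTS kapS kapwtS hsS s1 (m := m) (k := k)).
have n4 := e_near _ _ _ (de k) (dn_err_cvg hT kap_cvg0 kapwt_cvg0 hs s1 (m := m) (k := k)).
apply: filterS (filterI n1 (filterI n2 (filterI n3 (filterI n4 (tower_bound_near k))))).
move=> j [h1 [h2 [h3 [h4 h5]]]]; apply/and5P.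
exact: And5 h1 h2 h3 h4 h5.
Qed.

Section Cutoff.
Variables (m : R) (e : nat -> R) (N : nat -> nat).
Hypotheses (m_ge0 : 0 <= m) (e0 : e k @[k --> \oo] --> 0).
Hypothesis N_adm : admissible d C1 N.
Hypothesis N_oo : (fun j => N (sz j)) @ \oo --> \oo.
Hypothesis N_control :
  \forall j \near \oo, forall k, (k < N (sz j))%N -> tower_control m e k (sz j).

Let X j := tower_state (T (sz j)) (N (sz j)).

Lemma cutoff_up_close : vclose (fun j => up (T (sz j)) *m X j) (fun j => cmul m (X j)).
Proof.
apply: (tower_state_close m_ge0 e0 N_oo hT); near=> j => k kN.
have ctl : forall k, (k < N (sz j))%N -> tower_control m e k (sz j) by near: j.
by have /and5P[] := ctl k kN.
Unshelve. all: by end_near. Qed.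

Lemma cutoff_dn_close : vclose (fun j => dn (T (sz j)) *m X j) (fun j => cmul m (X j)).
Proof.
apply: (@vclose_trans _ _ (fun j => up (ladder_swap (T (sz j))) *m
    tower_state (ladder_swap (T (sz j))) (N (sz j)))).
  by apply: vclose_eq => j; rewrite tower_state_swap.
apply: (@vclose_trans _ _ (fun j =>
    cmul m (tower_state (ladder_swap (T (sz j))) (N (sz j))))); last first.
  by apply: vclose_eq => j; rewrite tower_state_swap.
apply: (tower_state_close m_ge0 e0 N_oo (fun j => ladder_swapP (hT j))); near=> j => k kN.
have ctl : forall k, (k < N (sz j))%N -> tower_control m e k (sz j) by near: j.
by have /and5P[_ _ h1 h2 _] := ctl k kN.
Unshelve. all: by end_near. Qed.

Lemma cutoff_norm : \forall j \near \oo, vnorm (X j) = 1.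
Proof.
near=> j; apply: (vnorm_tower_state (hT j)) => z zN; apply: tower_boundE => //.
have tb1 : 1 <= tower_bound d C1 (sz j) by near: j; exact: (tower_bound_near 0).
have [_] := N_adm (sz_size j) tb1; apply: le_trans.
by move: zN; rewrite abszE -(ler_int R).
Unshelve. all: by end_near. Qed.

End Cutoff.
End ThermodynamicLimit.

Unset Implicit Arguments.

(** As [g] is itself admissible and divergent, the class of cutoffs below [g] is not empty. *)
Theorem theorem3p3 (R : realType) (d D : nat) (S : lattice_system R d D)
    (a h0 o0 q0 C1 : R) (zeta : nat) (alpha : component) (sz : nat -> nat)
    (d_gt0 : (0 < d)%N)
    (Hham : forall L, lattice_size L -> hamiltonian S L)
    (a_gt0 : 0 < a)
    (HA1 : forall L, lattice_size L -> conserved_operator S a L)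
    (HA2 : forall L, lattice_size L -> order_operators S L)
    (HA3 : forall L, lattice_size L -> local_operators S zeta h0 o0 L)
    (HA4 : forall L, lattice_size L -> symmetric_ground_state S L)
    (q0_gt0 : 0 < q0)
    (HA5 : forall L, lattice_size L -> long_range_order S q0 L)
    (C1_gt0 : 0 < C1)
    (Htower : forall L, lattice_size L -> tower_well_defined S C1 L)
    (sz_size : forall j, lattice_size (sz j))
    (sz_incr : forall j, (sz j < sz j.+1)%N)
    (Hlim : forall k, (0 < k)%N ->
       cvgn (fun j : nat => order_moment S alpha k (sz j))) :
  let mstar := order_parameter S alpha sz in
  exists g : nat -> nat,
    [/\ admissible d C1 g,
        (fun j => g (sz j)) @ \oo --> \oo &
        forall Mmax : nat -> nat,
          admissible d C1 Mmax ->
          (fun j => Mmax (sz j)) @ \oo --> \oo ->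
          (forall j, (Mmax (sz j) <= g (sz j))%N) ->
          [/\ (fun j => expval (density (order_op S comp1 (sz j)))
                               (Xi S (sz j) (Mmax (sz j)))) @ \oo --> mstar,
              (fun j => expval (density (order_op S comp1 (sz j)) ^+ 2)
                               (Xi S (sz j) (Mmax (sz j)))) @ \oo --> mstar ^+ 2,
              (forall L, lattice_size L -> 1 <= tower_bound d C1 L ->
                 expval (density (order_op S comp2 L)) (Xi S L (Mmax L)) = 0) &
              (fun j => expval (density (order_op S comp2 (sz j)) ^+ 2)
                               (Xi S (sz j) (Mmax (sz j)))) @ \oo --> (0 : R)]].
Proof.
move=> mstar.
have [m [e [m_ge0 mE e0 ctl]]] := tower_control_exists d_gt0 HA1 HA2 HA3 HA4 q0_gt0 HA5
  C1_gt0 sz_size sz_incr Hlim.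
have sz_ge j : (j <= sz j)%N by rewrite ltnW// (sz_gt sz_size sz_incr).
have [g [g_gt0 g_oo g_ctl]] := slow_cutoff sz_ge ctl.
exists g; split=> //.
  move=> L hL tb1; split=> //.
  (* If [g L] is 1 the bound is [tb1]; if it is k + 2, the last clause of the control at k + 1 is
     the bound. *)
  case: (g L) (g_gt0 L) (g_ctl L) => [//|[|k]] _ gk //.
  by have /and5P[] := gk k.+1 isT (ltnSn _).
move=> N N_adm N_oo Ng.
have N_ctl : \forall j \near \oo, forall k, (k < N (sz j))%N ->
    tower_control S C1 m e k (sz j).
  (* Once the cutoff is at least 2, so is [g (sz j)], which excludes its default value 1. *)
  have /cvgnyPge /(_ 2%N) := N_oo; apply: filterS => j N2 k kN.
  by apply: g_ctl; apply: leq_trans (Ng j).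
have hT L (hL : lattice_size L) := T_ladder HA1 HA2 HA3 HA4 hL.
have XiT L : lattice_size L -> Xi S L (N L) = tower_state (system_ladder S L) (N L).
  by move=> hL; exact: (XiE (gs_norm HA4 hL) hL).
have X_le1 j := vnorm_tower_state_le1 (N (sz j)) (hT _ (sz_size j)).
have X_1 := cutoff_norm d_gt0 HA1 HA2 HA3 HA4 C1_gt0 Htower sz_size sz_incr N_adm.
have up_close := cutoff_up_close HA1 HA2 HA3 HA4 sz_size m_ge0 e0 N_oo N_ctl.
have dn_close := cutoff_dn_close HA1 HA2 HA3 HA4 sz_size m_ge0 e0 N_oo N_ctl.
have HA2' j := HA2 _ (sz_size j).
rewrite /mstar mE; split.
- under eq_fun do rewrite (XiT _ (sz_size _)).
  exact: order1_expval_cvg X_le1 X_1 up_close dn_close.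
- under eq_fun do rewrite (XiT _ (sz_size _)).
  exact: order1_sqr_cvg HA2' up_close dn_close.
- by move=> L hL _; rewrite (XiT L hL) (order2_expval0 _ (hT L hL)).
- under eq_fun do rewrite (XiT _ (sz_size _)).
  exact: order2_sqr_cvg HA2' up_close dn_close.
Qed.
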